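(* Let $k$ be an algebraically closed field and $d\ge 2$ an integer relatively prime to the characteristic of $k$. Let $R=k[s_2,f_2,b_{0i},b_{1i},c_{1i}\mid i=1,\dots,4]$ and let $K(2,d)\subseteq R$ be the ideal generated by $$b_{01}b_{03}^d-b_{04}b_{02}^d,\quad c_{1i}(b_{02}-b_{1i}b_{03}),\ c_{1i}(b_{01}-b_{1i}^db_{04})\ (i=1,\dots,4),\quad c_{1i}c_{1j}(b_{1i}-b_{1j})\ (1\le i<j\le 4),$$ $$b_{04}^dc_{11}-b_{01}^dc_{12},\quad b_{04}^dc_{14}-b_{01}^dc_{13},\quad b_{01}^d(c_{12}-c_{13}),\quad b_{04}^d(c_{12}b_{11}-c_{13}b_{14}),\quad b_{04}^dc_{12}(b_{12}-b_{13}).$$ Let $C_1=(c_{11},c_{12},c_{13},c_{14})$ and define $Q_{1\Lambda}=(b_{01},b_{04})+(c_{1i}\mid i\notin\Lambda)+(b_{02}-b_{1i}b_{03},\ b_{1i}-b_{1j}\mid i,j\in\Lambda)$ for $\Lambda\subseteq\{1,2,3,4\}$; $Q_2=C_1+(b_{01}b_{03}^d-b_{04}b_{02}^d)$; $Q_3=(c_{11},c_{12},c_{14},b_{01},b_{02},b_{13},b_{14})$; $Q_5=(c_{11},c_{14},b_{01},b_{02},b_{12},b_{13},c_{12}b_{11}-c_{13}b_{14})$; $Q_{17,2}=(b_{12}-b_{1i}\ (1\le i\le 4),\ c_{13}-c_{12},\ c_{11}-b_{12}^{d^2}c_{12},\ c_{14}-c_{11},\ b_{02}-b_{12}b_{03},\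 b_{01}-b_{12}^db_{04})$; $Q_{18,2}=C_1+(b_{11}-b_{1i}\ (1\le i\le4),\ b_{02}-b_{12}b_{03},\ b_{01}-b_{12}^db_{04})$; $Q_{19,2,1,\alpha}=C_1+(b_{11}-b_{14},\ b_{12}-b_{13},\ b_{02},\ b_{03},\ b_{01}-b_{12}^db_{04},\ b_{12}-\alpha b_{11})$ for $\alpha\in k$; $Q_{20}=C_1+(b_{11}-b_{14},\ b_{12}-b_{13},\ b_{01},b_{02},b_{03},b_{04})$. Then $$\mathrm{Ass}\big(R/K(2,d)\big)\subseteq\{Q_{1\Lambda'}\mid\emptyset\ne\Lambda'\subseteq\{1,2,3,4\}\}\cup\{Q_2,Q_3,Q_5,Q_{17,2},Q_{18,2},Q_{20}\}\cup\{Q_{19,2,1,\alpha}\mid\alpha^d=1\}.$$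
   Context: $\mathrm{Ass}$ denotes the set of associated primes. *)

(* Defs.v *)
From HB Require Import structures.
From mathcomp Require Import all_boot all_order all_algebra all_field.
From mathcomp Require Import mpoly.
Set Implicit Arguments. Unset Strict Implicit. Unset Printing Implicit Defensive.
Import GRing.Theory.
Local Open Scope ring_scope.

(* Polynomial ring R = k[s2, f2, b01..b04, b11..b14, c11..c14] in 14 variables.
   Variable numbering: s2 = 0, f2 = 1, b0i = 1+i, b1i = 5+i, c1i = 9+i (i=1..4). *)
Notation RP k := ({mpoly k[14]}).

Section Gens.
Variable k : closedFieldType.

Definition var (n : nat) : RP k := 'X_(inord n).
Definition s2 : RP k := var 0.
Definition f2 : RP k := var 1.
Definition b0 (i : nat) : RP k := var (1 + i).
Definition b1 (i : nat) : RP k := var (5 + i).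
Definition c1 (i : nat) : RP k := var (9 + i).

Definition ideal_gen (S : seq (RP k)) : RP k -> Prop :=
  fun p => exists c : 'I_(size S) -> RP k, p = \sum_(i < size S) c i * S`_i.

Definition same_ideal (P Q : RP k -> Prop) := forall p, P p <-> Q p.

Definition is_prime_ideal (P : RP k -> Prop) :=
  [/\ P 0, (forall a b, P a -> P b -> P (a + b)),
      (forall r a, P a -> P (r * a)), ~ P 1 &
      (forall a b, P (a * b) -> P a \/ P b)].

Definition colon (I : RP k -> Prop) (f : RP k) : RP k -> Prop := fun g => I (g * f).

Definition Ass (I : RP k -> Prop) (P : RP k -> Prop) :=
  is_prime_ideal P /\ exists f, same_ideal P (colon I f).

Definition K2d_gens (d : nat) : seq (RP k) :=
  [:: b0 1 * b0 3 ^+ d - b0 4 * b0 2 ^+ d]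
  ++ [seq c1 i * (b0 2 - b1 i * b0 3) | i <- iota 1 4]
  ++ [seq c1 i * (b0 1 - b1 i ^+ d * b0 4) | i <- iota 1 4]
  ++ [seq c1 ij.1 * c1 ij.2 * (b1 ij.1 - b1 ij.2)
        | ij <- [seq (i, j) | i <- iota 1 4, j <- iota 1 4] & (ij.1 < ij.2)%N]
  ++ [:: b0 4 ^+ d * c1 1 - b0 1 ^+ d * c1 2;
         b0 4 ^+ d * c1 4 - b0 1 ^+ d * c1 3;
         b0 1 ^+ d * (c1 2 - c1 3);
         b0 4 ^+ d * (c1 2 * b1 1 - c1 3 * b1 4);
         b0 4 ^+ d * c1 2 * (b1 2 - b1 3)].

Definition K2d (d : nat) := ideal_gen (K2d_gens d).

Definition C1_gens : seq (RP k) := [:: c1 1; c1 2; c1 3; c1 4].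

(* Lambda is a subset of {1,2,3,4}, encoded as {set 'I_4} with i : 'I_4 standing for i+1 *)
Definition Q1 (L : {set 'I_4}) := ideal_gen (
  [:: b0 1; b0 4]
  ++ [seq c1 (val i).+1 | i <- enum (~: L)]
  ++ [seq b0 2 - b1 (val i).+1 * b0 3 | i <- enum L]
  ++ [seq b1 (val ij.1).+1 - b1 (val ij.2).+1 | ij <- [seq (i, j) | i <- enum L, j <- enum L]]).

Definition Q2 (d : nat) := ideal_gen (C1_gens ++ [:: b0 1 * b0 3 ^+ d - b0 4 * b0 2 ^+ d]).

Definition Q3 := ideal_gen [:: c1 1; c1 2; c1 4; b0 1; b0 2; b1 3; b1 4].

Definition Q5 := ideal_gen [:: c1 1; c1 4; b0 1; b0 2; b1 2; b1 3; c1 2 * b1 1 - c1 3 * b1 4].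

Definition Q17_2 (d : nat) := ideal_gen (
  [seq b1 2 - b1 i | i <- iota 1 4]
  ++ [:: c1 3 - c1 2; c1 1 - b1 2 ^+ (d ^ 2) * c1 2; c1 4 - c1 1;
         b0 2 - b1 2 * b0 3; b0 1 - b1 2 ^+ d * b0 4]).

Definition Q18_2 (d : nat) := ideal_gen (
  C1_gens ++ [seq b1 1 - b1 i | i <- iota 1 4]
  ++ [:: b0 2 - b1 2 * b0 3; b0 1 - b1 2 ^+ d * b0 4]).

Definition Q19_2_1 (d : nat) (alpha : k) := ideal_gen (
  C1_gens ++ [:: b1 1 - b1 4; b1 2 - b1 3; b0 2; b0 3;
                 b0 1 - b1 2 ^+ d * b0 4; b1 2 - alpha *: b1 1]).

Definition Q20 := ideal_gen (
  C1_gens ++ [:: b1 1 - b1 4; b1 2 - b1 3; b0 1; b0 2; b0 3; b0 4]).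

End Gens.

(* Main.v *)
Require Import Defs.
From HB Require Import structures.
From mathcomp Require Import all_boot all_order all_algebra all_field.
From mathcomp Require Import mpoly ring.
From Stdlib Require Import ClassicalEpsilon.
Import GRing.Theory.
Local Open Scope ring_scope.
Set Implicit Arguments. Unset Strict Implicit. Unset Printing Implicit Defensive.

(* Write P = (K : f), K = K(2,d), x = b04^d, N = d^2, and let K0 be K without its
   last five generators.  The element f is never changed: for each candidate prime Q
   we use a Q-primary ideal containing K, described as the set of r such that a
   power of a variable y divides phi(r), for a substitution morphism phi.  As soon as
   f lies outside that ideal, P is contained in Q; the opposite inclusion comes from
   computing in R/K localised at P, where elements outside P are regular.
   - If some c_1i is not in P, the localised relations express b01, b02 and most of
     the other variables through a few of them, and the cases b04 in P, c12 in P,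
     b12 in P give the primes Q1, Q3, Q5, Q17.
   - If all the c_1i lie in P and f is not in Q2, then P = Q2.  Otherwise f is
     congruent modulo K to a multiple e * g of e = x * c11, an element which is
     also equal, modulo K, to b01^d c12, b01^d c13 and x * c14.  The annihilator of
     e modulo K is the intersection of Q17, Q20 and the Q19 with alpha <> 1, and g
     lies in Q17, so P is one of the others. *)

(** All computations are equations between images of variables in a quotient ring: a polynomial may
    be replaced by a substituted one as soon as the two agree there on every variable. Localisation
    needs no fractions: dividing by the elements that some member of a multiplicative set multiplies
    into K makes the members of that set regular. The constant N = d^2 comes from raising c1i b01 =
    c1i b1i^d b04 to the power d: next to c1i, b01^d equals b1i^N x, so that generators containing
    b01^d acquire the factor x. The delicate primes are those where a relation such as b12^N (b11 -
    b12) = 0 cannot be simplified, because b12 lies in P, or where b04 lies in P and x cannot be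
    cancelled. There f is shown to lie outside the primary ideal by contradiction: membership would
    make the image of f vanish in the localisation, against P = (K : f). *)

Section Ideals.
Variable R : comNzRingType.
Implicit Types (I J P : R -> Prop) (r : R).

Definition is_ideal I :=
  [/\ I 0, (forall a b, I a -> I b -> I (a + b)) & (forall r a, I a -> I (r * a))].

Definition boolp_pred I : R -> bool :=
  fun r => if excluded_middle_informative (I r) then true else false.

Lemma boolp_predP I r : reflect (I r) (boolp_pred I r).
Proof. by rewrite /boolp_pred; case: excluded_middle_informative => h; constructor. Qed.

Section Quotient.
Variable I : R -> Prop.
Hypotheses (idI : is_ideal I) (prI : ~ I 1).

Definition ideal_pred (_ : is_ideal I) (_ : ~ I 1) := boolp_pred I.
Local Notation Ip := (ideal_pred idI prI).

Lemma ideal_pred_closed : idealr_closed Ip.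
Proof.
case: idI => h0 hD hM; split; first exact/boolp_predP.
  by apply/negP => /boolp_predP.
by move=> a x y /boolp_predP hx /boolp_predP hy; apply/boolp_predP/hD => //; apply: hM.
Qed.

Definition ideal_idealr : idealr R :=
  HB.pack_for (idealr R) Ip (isIdealr.Build R Ip ideal_pred_closed).

(** [{ideal_quot _}] asks for a boolean predicate and a nontrivial ring, hence excluded middle and
    the condition that 1 is not in [I]. Only the kernel and the surjectivity of the projection are
    retained. *)
Lemma quotient_exists : exists (A : comNzRingType) (pi : {rmorphism R -> A}),
  (forall r, I r <-> pi r = 0) /\ (forall x, exists r, x = pi r).
Proof.
pose Q := {ideal_quot ideal_idealr}.
exists Q, (\pi_Q)%qT.
split => [r|x]; last by exists (repr x); apply/esym/reprK.
have -> : I r <-> r \in ideal_idealr by split => [h|/boolp_predP]; first exact/boolp_predP.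
rewrite -{1}[r]subr0 Quotient.idealrBE.
have e0 : (\pi_Q 0)%qT = 0 := rmorph0 (\pi_Q)%qT.
by split=> [/eqP h|h]; [rewrite -e0 -h | apply/eqP; rewrite e0].
Qed.
End Quotient.
End Ideals.

Fact va_key : unit. Proof. exact: tt. Qed.
Fact vb_key : unit. Proof. exact: tt. Qed.
Fact vc_key : unit. Proof. exact: tt. Qed.

(* Sealed copies of the variables: b1 4 and c1 0 are convertible, which would
   confuse rewriting with the evaluation lemmas below. *)
Definition va (k : closedFieldType) := locked_with va_key (b0 k).
Definition vb (k : closedFieldType) := locked_with vb_key (b1 k).
Definition vc (k : closedFieldType) := locked_with vc_key (c1 k).

Lemma vaE k : va k = b0 k. Proof. exact: locked_withE. Qed.
Lemma vbE k : vb k = b1 k. Proof. exact: locked_withE. Qed.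
Lemma vcE k : vc k = c1 k. Proof. exact: locked_withE. Qed.

(** * Generated ideals, induction on polynomials, substitution morphisms *)

Section Poly.
Variable k : closedFieldType.
Local Notation R := {mpoly k[14]}.
Local Notation aa := (va k).
Local Notation bb := (vb k).
Local Notation cc := (vc k).
Implicit Types (I J : R -> Prop) (S : seq R).

Lemma ideal_gen_ideal S : is_ideal (@ideal_gen k S).
Proof.
split=> [|x y [u ->] [v ->]|r x [u ->]].
- by exists (fun=> 0); rewrite big1 // => i _; rewrite mul0r.
- by exists (fun i => u i + v i); rewrite -big_split; apply: eq_bigr => i _; rewrite mulrDl.
- by exists (fun i => r * u i); rewrite mulr_sumr; apply: eq_bigr => i _; rewrite mulrA.
Qed.

Lemma ideal_gen_mem S i : (i < size S)%N -> ideal_gen S S`_i.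
Proof.
move=> lti; exists (fun j => (j == Ordinal lti)%:R).
rewrite (bigD1 (Ordinal lti)) //= eqxx mul1r big1 ?addr0 // => j /negbTE ->.
by rewrite mul0r.
Qed.

Lemma mem_ideal_gen S x : x \in S -> ideal_gen S x.
Proof. by move=> xS; rewrite -(nth_index 0 xS); apply: ideal_gen_mem; rewrite index_mem. Qed.

Lemma ideal_sum I n (F : 'I_n -> R) : is_ideal I -> (forall i, I (F i)) -> I (\sum_i F i).
Proof. by case=> h0 hD _ hF; elim/big_ind: _. Qed.

Lemma ideal_gen_min S I : is_ideal I -> {in S, forall x, I x} ->
  forall r, ideal_gen S r -> I r.
Proof.
move=> idI hS r [u ->]; apply: ideal_sum => // i.
by case: idI => _ _; apply; apply/hS/mem_nth.
Qed.

Lemma ideal_gen_cons S x r : ideal_gen (x :: S) r -> exists t, ideal_gen S (r - x * t).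
Proof.
case=> u ->; exists (u ord0); exists (fun i => u (lift ord0 i)).
by rewrite big_ord_recl /= mulrC addrC addKr.
Qed.

Lemma mpoly_ring_ind (Q : R -> Prop) :
  (forall z, Q z%:MP) -> Q (s2 k) -> Q (f2 k) ->
  (forall i, (0 < i <= 4)%N -> [/\ Q (aa i), Q (bb i) & Q (cc i)]) ->
  (forall p q, Q p -> Q q -> Q (p + q)) -> (forall p q, Q p -> Q q -> Q (p * q)) ->
  forall r, Q r.
Proof.
rewrite vaE vbE vcE => hC hs hf habc hD hM r.
have hv (i : 'I_14) : Q 'X_i.
  have -> : 'X_i = var k i by rewrite /var inord_val.
  case: i => [[|[|n]] hn] //=.
  (* The variable has index [n + 2], so the blocks [b0], [b1], [c1] begin at [n] equal to 0, 4 and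
     8. *)
  have [h1|h1] := leqP n 3.
    by have [] := habc n.+1 h1.
  have [h2|h2] := leqP n 7.
    have [|_ + _] := habc (n - 3)%N; first by rewrite subn_gt0 h1 leq_subLR.
    by rewrite /b1 -[(5 + _)%N]/((2 + (3 + (n - 3)))%N) subnKC // ltnW.
  have [|_ _ +] := habc (n - 7)%N; first by rewrite subn_gt0 h2 leq_subLR.
  by rewrite /c1 -[(9 + _)%N]/((2 + (7 + (n - 7)))%N) subnKC // ltnW.
elim/mpolyind: r => [|z m p _ _ hp]; first by rewrite -mpolyC0.
apply: (hD) => //; rewrite -mul_mpolyC; apply: (hM) => //.
rewrite mpolyXE_id; elim/big_ind: _ => [|u v|i _]; [by rewrite -mpolyC1 | exact: hM |].
by elim: (m i) => [|n IH]; [rewrite expr0 -mpolyC1|rewrite exprS; apply: hM].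
Qed.

Lemma var_neq0 n : var k n != 0.
Proof.
apply/eqP => /(congr1 (mcoeff U_(inord n))); rewrite /var mcoeffX eqxx mcoeff0.
by apply/eqP; rewrite oner_eq0.
Qed.

Lemma hom_ext (A : comNzRingType) (phi psi : {rmorphism R -> A}) :
  (forall z, phi z%:MP = psi z%:MP) -> phi (s2 k) = psi (s2 k) -> phi (f2 k) = psi (f2 k) ->
  (forall i, (0 < i <= 4)%N ->
     [/\ phi (aa i) = psi (aa i), phi (bb i) = psi (bb i) & phi (cc i) = psi (cc i)]) ->
  phi =1 psi.
Proof.
move=> hC hs hf habc; elim/mpoly_ring_ind => // p q; first by rewrite !rmorphD => -> ->.
by rewrite !rmorphM => -> ->.
Qed.

Lemma aa_neq0 i : aa i != 0. Proof. by rewrite vaE; apply: var_neq0. Qed.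
Lemma bb_neq0 i : bb i != 0. Proof. by rewrite vbE; apply: var_neq0. Qed.
Lemma cc_neq0 i : cc i != 0. Proof. by rewrite vcE; apply: var_neq0. Qed.

Fact subst_key : unit. Proof. exact: tt. Qed.

Section Subst.
Variables (A : comNzRingType) (h : {rmorphism R -> A}) (wa wb wc : nat -> A).

Definition subst_val (n : nat) : A :=
  if (n <= 1)%N then h (var k n) else if (n <= 5)%N then wa (n - 1)
  else if (n <= 9)%N then wb (n - 5) else wc (n - 9).

(* the k-algebra morphism sending b0 i, b1 i, c1 i to wa i, wb i, wc i, and acting
   as h on the constants and on s2, f2 *)
Definition subst : R -> A :=
  locked_with subst_key (mmap (h \o @mpolyC 14 k) (fun i => subst_val i)).

Lemma substE : subst = mmap (h \o @mpolyC 14 k) (fun i => subst_val i).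
Proof. exact: locked_withE. Qed.

Fact subst_zmod_morphism : zmod_morphism subst.
Proof. by rewrite substE; exact: raddfB. Qed.
Fact subst_monoid_morphism : monoid_morphism subst.
Proof. by rewrite substE; split; [exact: rmorph1 | exact: rmorphM]. Qed.
HB.instance Definition _ := GRing.isZmodMorphism.Build R A subst subst_zmod_morphism.
HB.instance Definition _ := GRing.isMonoidMorphism.Build R A subst subst_monoid_morphism.

Lemma subst_var n : (n < 14)%N -> subst (var k n) = subst_val n.
Proof. by move=> hn; rewrite substE /var mmapX mmap1U inordK. Qed.

Lemma substC z : subst z%:MP = h z%:MP.
Proof. by rewrite substE mmapC. Qed.

Lemma subst_s2 : subst (s2 k) = h (s2 k). Proof. by rewrite subst_var. Qed.
Lemma subst_f2 : subst (f2 k) = h (f2 k). Proof. by rewrite subst_var. Qed.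

Lemma subst_aa i : (0 < i <= 4)%N -> subst (aa i) = wa i.
Proof. by rewrite vaE; case: i => [|[|[|[|[|i]]]]] // _; rewrite subst_var. Qed.
Lemma subst_bb i : (0 < i <= 4)%N -> subst (bb i) = wb i.
Proof. by rewrite vbE; case: i => [|[|[|[|[|i]]]]] // _; rewrite subst_var. Qed.
Lemma subst_cc i : (0 < i <= 4)%N -> subst (cc i) = wc i.
Proof. by rewrite vcE; case: i => [|[|[|[|[|i]]]]] // _; rewrite subst_var. Qed.

Definition subst_vars :=
  ((@subst_aa 1 isT, @subst_aa 2 isT, @subst_aa 3 isT, @subst_aa 4 isT),
   (@subst_bb 1 isT, @subst_bb 2 isT, @subst_bb 3 isT, @subst_bb 4 isT),
   (@subst_cc 1 isT, @subst_cc 2 isT, @subst_cc 3 isT, @subst_cc 4 isT)).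

Lemma hom_subst (B : comNzRingType) (phi : {rmorphism A -> B}) (psi : {rmorphism R -> B}) :
  (forall z, phi (h z%:MP) = psi z%:MP) -> phi (h (s2 k)) = psi (s2 k) ->
  phi (h (f2 k)) = psi (f2 k) ->
  (forall i, (0 < i <= 4)%N ->
     [/\ phi (wa i) = psi (aa i), phi (wb i) = psi (bb i) & phi (wc i) = psi (cc i)]) ->
  forall r, phi (subst r) = psi r.
Proof.
move=> hC hs hf habc; apply: (@hom_ext _ (phi \o subst)) => [z|||i hi].
- by rewrite -hC -substC.
- by rewrite -hs -subst_s2.
- by rewrite -hf -subst_f2.
- by have [<- <- <-] := habc i hi; rewrite -[wa i]subst_aa // -[wb i]subst_bb // -[wc i]subst_cc.
Qed.
End Subst.

Notation sub := (subst idfun).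

Lemma hom_sub (B : comNzRingType) (pi : {rmorphism R -> B}) wa wb wc :
  (forall i, (0 < i <= 4)%N ->
     [/\ pi (wa i) = pi (aa i), pi (wb i) = pi (bb i) & pi (wc i) = pi (cc i)]) ->
  forall r, pi (sub wa wb wc r) = pi r.
Proof. by move=> h; apply: (hom_subst (h := idfun)). Qed.

(** In R/I the substitution and the identity agree on the variables, hence everywhere. This is how
    polynomials are brought to normal form modulo relations. The case [I 1] is apart because the
    quotient has to be nontrivial. *)
Lemma sub_congr I wa wb wc : is_ideal I ->
  (forall i, (0 < i <= 4)%N ->
     [/\ I (aa i - wa i), I (bb i - wb i) & I (cc i - wc i)]) ->
  forall r, I (r - sub wa wb wc r).
Proof.
move=> idI h r; case: (excluded_middle_informative (I 1)) => [I1|I1].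
  by case: idI => _ _ hM; rewrite -[_ - _]mulr1; apply: hM.
have [A [pi [hpi _]]] := quotient_exists idI I1.
apply/hpi; rewrite rmorphB hom_sub ?subrr // => i /h [/hpi + /hpi + /hpi].
by rewrite !rmorphB => /subr0_eq -> /subr0_eq -> /subr0_eq ->.
Qed.

Lemma sub_sub wa wb wc va vb vc ua ub uc :
  (forall i, (0 < i <= 4)%N ->
     [/\ sub wa wb wc (va i) = ua i, sub wa wb wc (vb i) = ub i & sub wa wb wc (vc i) = uc i]) ->
  forall r, sub wa wb wc (sub va vb vc r) = sub ua ub uc r.
Proof.
move=> h; apply: (hom_subst (h := idfun)) => [z|||i hi].
- by rewrite /= !substC.
- by rewrite /= !subst_s2.
- by rewrite /= !subst_f2.
- by rewrite /=; have [-> -> ->] := h i hi; rewrite subst_aa // subst_bb // subst_cc.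
Qed.
End Poly.

(** * Consequences of the relations of K in a commutative ring *)

Section Relations.
Variables (A : comNzRingType) (d : nat).
Implicit Types (x y z : A) (a b c : nat -> A).

(** Regular elements stand in for the units of a localisation. *)
Definition reg x := forall y, x * y = 0 -> y = 0.

Lemma regX x n : reg x -> reg (x ^+ n).
Proof.
move=> rx; elim: n => [|n IH] y; first by rewrite mul1r.
by rewrite exprS -mulrA => /rx /IH.
Qed.

Lemma reg_cancel x y z : reg x -> x * y = x * z -> y = z.
Proof. by move=> rx e; apply/subr0_eq/rx; rewrite mulrBr e subrr. Qed.

(** The hypothesis is a congruence modulo the annihilator of [x], which is an ideal, so it passes to
    powers. *)
Lemma mulr_congrX x y z n : x * y = x * z -> x * y ^+ n = x * z ^+ n.
Proof.
move=> e; elim: n => // n IH.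
by rewrite !exprS mulrCA IH mulrCA mulrA e mulrA.
Qed.

Record Krel0 a b c : Prop := MkKrel0 {
  krel_g0 : a 1 * a 3 ^+ d = a 4 * a 2 ^+ d;
  krel_p2 : forall i, (0 < i <= 4)%N -> c i * a 2 = c i * (b i * a 3);
  krel_p1 : forall i, (0 < i <= 4)%N -> c i * a 1 = c i * (b i ^+ d * a 4);
  krel_bb : forall i j, (0 < i <= 4)%N -> (0 < j <= 4)%N -> c i * c j * (b i - b j) = 0 }.

Record Krel a b c : Prop := MkKrel {
  krel_0 :> Krel0 a b c;
  krel_h1 : a 4 ^+ d * c 1 = a 1 ^+ d * c 2;
  krel_h2 : a 4 ^+ d * c 4 = a 1 ^+ d * c 3;
  krel_h3 : a 1 ^+ d * c 2 = a 1 ^+ d * c 3;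
  krel_h4 : a 4 ^+ d * (c 2 * b 1) = a 4 ^+ d * (c 3 * b 4);
  krel_h5 : a 4 ^+ d * (c 2 * b 2) = a 4 ^+ d * (c 2 * b 3) }.

Local Notation N := (d ^ 2)%N.

Lemma exprN x : x ^+ N = (x ^+ d) ^+ d.
Proof. by rewrite -exprM mulnn. Qed.

Section Consequences.
Variables a b c : nat -> A.
Hypothesis hK : Krel a b c.

Lemma krel_a1X i : (0 < i <= 4)%N -> c i * a 1 ^+ d = c i * (b i ^+ N * a 4 ^+ d).
Proof. by move=> hi; rewrite exprN -exprMn; apply/mulr_congrX/(krel_p1 hK). Qed.

Lemma krel_reg_a1 i : (0 < i <= 4)%N -> reg (c i) -> a 1 = b i ^+ d * a 4.
Proof. by move=> hi rc; apply: (reg_cancel rc); apply: (krel_p1 hK). Qed.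

Lemma krel_reg_a2 i : (0 < i <= 4)%N -> reg (c i) -> a 2 = b i * a 3.
Proof. by move=> hi rc; apply: (reg_cancel rc); apply: (krel_p2 hK). Qed.

Lemma krel_reg_bb i j : (0 < i <= 4)%N -> (0 < j <= 4)%N -> reg (c i) ->
  c j * (b j - b i) = 0.
Proof.
move=> hi hj rc; apply: rc; rewrite mulrA -[b j - b i]opprB mulrN.
by rewrite (krel_bb hK) // oppr0.
Qed.

Lemma krel_reg_a1X i : (0 < i <= 4)%N -> reg (c i) -> a 1 ^+ d = b i ^+ N * a 4 ^+ d.
Proof. by move=> hi rc; rewrite (krel_reg_a1 hi rc) exprMn exprN. Qed.

(** Since [c 2] is regular, [a 1 ^+ d] is [b 2 ^+ N * a 4 ^+ d]; each of the last five relations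
    becomes a multiple of [a 4 ^+ d], which is cancelled. The factor [b 2 ^+ N] surviving in the
    last three equations is what separates Q5 from Q17. *)
Lemma krel_reg42 : reg (a 4) -> reg (c 2) ->
  [/\ [/\ a 2 = b 2 * a 3, a 1 = b 2 ^+ d * a 4 & b 3 = b 2],
      [/\ c 2 * b 1 = c 3 * b 4, c 1 = b 2 ^+ N * c 2 & c 4 = b 2 ^+ N * c 3] &
      [/\ b 2 ^+ N * (c 2 - c 3) = 0, b 2 ^+ N * (b 1 - b 2) = 0 & b 2 ^+ N * (b 4 - b 2) = 0]].
Proof.
move=> r4 rc.
have r4d : reg (a 4 ^+ d) by apply: regX.
have a1X : a 1 ^+ d = b 2 ^+ N * a 4 ^+ d by apply: krel_reg_a1X.
have e3 : b 3 = b 2.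
  by apply: (reg_cancel rc); apply: (reg_cancel r4d); rewrite (krel_h5 hK).
have e4 : c 2 * b 1 = c 3 * b 4 by apply: (reg_cancel r4d); rewrite (krel_h4 hK).
have ec1 : c 1 = b 2 ^+ N * c 2.
  by apply: (reg_cancel r4d); rewrite (krel_h1 hK) a1X; ring.
have ec4 : c 4 = b 2 ^+ N * c 3.
  by apply: (reg_cancel r4d); rewrite (krel_h2 hK) a1X; ring.
have ec : b 2 ^+ N * (c 2 - c 3) = 0.
  apply: r4d; transitivity (a 1 ^+ d * c 2 - a 1 ^+ d * c 3); last by rewrite (krel_h3 hK) subrr.
  by rewrite a1X; ring.
have eb1 : b 2 ^+ N * (b 1 - b 2) = 0.
  apply: (rc); have := @krel_reg_bb 2 1 isT isT rc; rewrite ec1 => <-; ring.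
have eb4 : b 2 ^+ N * (b 4 - b 2) = 0.
  have := @krel_reg_bb 2 4 isT isT rc; rewrite ec4 => h.
  apply: (rc); rewrite -h; apply/subr0_eq.
  transitivity ((b 2 ^+ N * (c 2 - c 3)) * (b 4 - b 2)); first by ring.
  by rewrite ec mul0r.
split; split => //; [exact: krel_reg_a2 | exact: krel_reg_a1].
Qed.

Lemma krel_reg4223 : reg (a 4) -> reg (c 2) -> reg (b 2) ->
  [/\ b 1 = b 2, b 4 = b 2, c 3 = c 2, c 1 = b 2 ^+ N * c 2 & c 4 = c 1].
Proof.
move=> r4 rc rb; have [_ [_ ec1 ec4] [ec eb1 eb4]] := krel_reg42 r4 rc.
have rN := @regX _ N rb; move/rN/subr0_eq: ec => ec.
by split; rewrite ?ec1 ?ec4 ?ec //; [apply/subr0_eq/rN | apply/subr0_eq/rN].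
Qed.

(** Regularity of [c 2 - c 3] turns [krel_h3] into [a 1 ^+ d = 0], which makes [b 3] nilpotent. *)
Lemma krel_reg43 : reg (a 4) -> reg (c 3) -> reg (c 2 - c 3) ->
  [/\ a 2 = b 3 * a 3, a 1 = b 3 ^+ d * a 4 & b 3 ^+ N = 0] /\
  [/\ c 1 = 0, c 4 = 0 & c 3 * b 4 = c 2 * b 1].
Proof.
move=> r4 rc rcc.
have r4d : reg (a 4 ^+ d) by apply: regX.
have a1X : a 1 ^+ d = b 3 ^+ N * a 4 ^+ d by apply: krel_reg_a1X.
have a10 : a 1 ^+ d = 0 by apply: rcc; rewrite mulrC mulrBr (krel_h3 hK) subrr.
split; split; [exact: krel_reg_a2 | exact: krel_reg_a1 | | | |].
- by apply: r4d; rewrite mulrC -a1X.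
- by apply: r4d; rewrite (krel_h1 hK) a10 mul0r.
- by apply: r4d; rewrite (krel_h2 hK) a10 mul0r.
- by apply: (reg_cancel r4d); rewrite (krel_h4 hK).
Qed.

Lemma krel_e i j : (0 < i <= 4)%N -> (0 < j <= 4)%N ->
  let w := fun i => if (i == 1)%N || (i == 4)%N then a 4 else a 1 in
  w i ^+ d * c i = w j ^+ d * c j.
Proof.
move=> hi hj w; have [[h1 h2] h3] := (krel_h1 hK, krel_h2 hK, krel_h3 hK).
suff e l : (0 < l <= 4)%N -> w l ^+ d * c l = a 4 ^+ d * c 1 by rewrite !e.
by case: l => [|[|[|[|[|l]]]]] // _; rewrite /w /= ?h2 ?h1 ?h3.
Qed.

Local Notation e := (a 4 ^+ d * c 1).

(** Being a multiple of every [c i], this element obeys the relations attached to all four indices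
    at once; comparing two indices then gives new equations. *)
Lemma krel_eE i : (0 < i <= 4)%N -> exists u, e = u * c i.
Proof.
by move=> hi; eexists; rewrite (@krel_e 1 i isT hi); reflexivity.
Qed.

Lemma krel_e_a2 i : (0 < i <= 4)%N -> e * a 2 = e * (b i * a 3).
Proof. by move=> hi; have [u ->] := krel_eE hi; rewrite -!mulrA (krel_p2 hK). Qed.

Lemma krel_e_a1 i : (0 < i <= 4)%N -> e * a 1 = e * (b i ^+ d * a 4).
Proof. by move=> hi; have [u ->] := krel_eE hi; rewrite -!mulrA (krel_p1 hK). Qed.

Lemma krel_e_bb i j : (0 < i <= 4)%N -> (0 < j <= 4)%N -> e * (c i * (b i - b j)) = 0.
Proof.
move=> hi hj; have [u ->] := krel_eE hj.
transitivity (u * (c i * c j * (b i - b j))); first by ring.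
by rewrite (krel_bb hK) // mulr0.
Qed.

Lemma krel_e2 : e = b 2 ^+ N * (a 4 ^+ d * c 2).
Proof.
by rewrite (krel_h1 hK) mulrC (@krel_a1X 2) //; ring.
Qed.

Lemma krel_e3 : e = b 3 ^+ N * (a 4 ^+ d * c 3).
Proof.
by rewrite (krel_h1 hK) (krel_h3 hK) mulrC (@krel_a1X 3) //; ring.
Qed.

Lemma krel_e_b23 : e * b 3 = e * b 2.
Proof.
rewrite krel_e2; have := krel_h5 hK => h.
transitivity (b 2 ^+ N * (a 4 ^+ d * (c 2 * b 3))); first by ring.
by rewrite -h; ring.
Qed.

(** Written as [b 3 ^+ N * (a 4 ^+ d * c 3)], the element turns [b 4] into [b 1] by [krel_h4], with
    [c 3] becoming [c 2]; next to [a 4 ^+ d * c 2] the powers of [b 3] and [b 2] agree, which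
    restores the element. *)
Lemma krel_e_b14 : e * b 4 = e * b 1.
Proof.
rewrite {2}krel_e2 krel_e3.
have h4 := krel_h4 hK; have h5 : a 4 ^+ d * c 2 * b 3 = a 4 ^+ d * c 2 * b 2.
  by rewrite -mulrA -(krel_h5 hK) mulrA.
transitivity (b 3 ^+ N * (a 4 ^+ d * (c 3 * b 4))); first by ring.
rewrite -h4; transitivity (a 4 ^+ d * c 2 * b 3 ^+ N * b 1); first by ring.
by rewrite (mulr_congrX _ h5); ring.
Qed.

Lemma krel_e_c : [/\ e * c 1 = e * (b 2 ^+ N * c 2), e * c 3 = e * c 2 & e * c 4 = e * c 1].
Proof.
have [[h1 h2] h3] := (krel_h1 hK, krel_h2 hK, krel_h3 hK).
split.
- transitivity (c 2 * a 1 ^+ d * c 1); first by rewrite h1; ring.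
  by rewrite (@krel_a1X 2) //; ring.
- by rewrite h1 {2}h3; ring.
- have e4 : e = a 4 ^+ d * c 4 by rewrite h2 h1 h3.
  by rewrite {2}e4; ring.
Qed.

Lemma krel_e_b12 : [/\ e * ((b 1 - b 2) * a 3) = 0 & e * ((b 1 ^+ d - b 2 ^+ d) * a 4) = 0].
Proof.
split; rewrite !(mulrBl, mulrBr).
  by rewrite -!krel_e_a2 ?subrr.
by rewrite -!krel_e_a1 ?subrr.
Qed.

(** These relations hold modulo K + (e); their exponents N match those of the primary ideals at Q3
    and Q5. *)
Lemma krel_mod_e : e = 0 ->
  [/\ a 4 ^+ d * c 1 = 0, a 4 ^+ d * c 4 = 0,
      a 4 ^+ d * (c 2 * b 2 ^+ N) = 0 & a 4 ^+ d * (c 3 * b 3 ^+ N) = 0].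
Proof.
move=> e0; split => //.
- by rewrite (krel_h2 hK) -(krel_h3 hK) -(krel_h1 hK).
- by rewrite mulrA mulrC -krel_e2.
- by rewrite mulrA mulrC -krel_e3.
Qed.
End Consequences.
End Relations.

Definition four (T : Type) (x1 x2 x3 x4 : T) (i : nat) : T :=
  match i with 1 => x1 | 2 => x2 | 3 => x3 | _ => x4 end.

Section MayrMeyer.
Variables (k : closedFieldType) (d : nat).
Local Notation R := {mpoly k[14]}.
Local Notation sub := (subst (idfun : {rmorphism R -> R})).
Local Notation aa := (va k).
Local Notation bb := (vb k).
Local Notation cc := (vc k).
Local Notation N := (d ^ 2)%N.
Local Notation K := (@K2d k d).
Implicit Types (I J P : R -> Prop) (r f g x y : R).

Ltac four_cases := case=> [|[|[|[|[|?]]]]] // _.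
Ltac hom := rewrite ?(rmorphB, rmorphD, rmorphM, rmorphXn, rmorph0) /= ?subst_vars /=.

Lemma ideal_gen_foldr S I : is_ideal I -> foldr (fun x Q => I x /\ Q) True S ->
  forall r, ideal_gen S r -> I r.
Proof.
move=> idI hS; apply: ideal_gen_min => //.
elim: S hS => [|x S IH] //= [Ix /IH hS] y; rewrite inE => /orP[/eqP -> //|].
exact: hS.
Qed.

Lemma ker_ideal (A : comNzRingType) (pi : {rmorphism R -> A}) : is_ideal (fun r => pi r = 0).
Proof.
split=> [|x y hx hy|r x hx]; first exact: rmorph0.
  by rewrite rmorphD hx hy addr0.
by rewrite rmorphM hx mulr0.
Qed.

Lemma idealB I r f : is_ideal I -> I r -> I f -> I (r - f).
Proof. by case=> _ hD hM hr hf; apply: hD => //; rewrite -mulN1r; apply: hM. Qed.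

Lemma ideal_congr I r f : is_ideal I -> I (r - f) -> I r <-> I f.
Proof.
move=> idI h; split => h'; last by rewrite -(subrK f r); case: idI => _ + _; apply.
by rewrite -[f](subKr r); apply: idealB.
Qed.

(** * Generators of K and the relations between their images *)

Definition K0_gens : seq R :=
  [:: aa 1 * aa 3 ^+ d - aa 4 * aa 2 ^+ d]
  ++ [seq cc i * (aa 2 - bb i * aa 3) | i <- iota 1 4]
  ++ [seq cc i * (aa 1 - bb i ^+ d * aa 4) | i <- iota 1 4]
  ++ [seq cc ij.1 * cc ij.2 * (bb ij.1 - bb ij.2)
        | ij <- [seq (i, j) | i <- iota 1 4, j <- iota 1 4] & (ij.1 < ij.2)%N].

Definition K_gens : seq R :=
  [:: aa 4 ^+ d * cc 1 - aa 1 ^+ d * cc 2;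
      aa 4 ^+ d * cc 4 - aa 1 ^+ d * cc 3;
      aa 1 ^+ d * (cc 2 - cc 3);
      aa 4 ^+ d * (cc 2 * bb 1 - cc 3 * bb 4);
      aa 4 ^+ d * cc 2 * (bb 2 - bb 3)].

Lemma K2d_gens_cat : @K2d_gens k d = K0_gens ++ K_gens.
Proof. by rewrite /K0_gens /K_gens vaE vbE vcE. Qed.

Lemma case4 (Q : nat -> Prop) : Q 1 -> Q 2 -> Q 3 -> Q 4 -> forall i, (0 < i <= 4)%N -> Q i.
Proof. by move=> ? ? ? ? [|[|[|[|[|i]]]]]. Qed.

Lemma K0_krel (A : comNzRingType) (pi : {rmorphism R -> A}) :
  {in K0_gens, forall x, pi x = 0} -> Krel0 d (pi \o aa) (pi \o bb) (pi \o cc).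
Proof.
move=> h.
have hn i : (i < size K0_gens)%N -> pi K0_gens`_i = 0 by move=> hi; apply/h/mem_nth.
split => /= [|||].
- by have := hn 0 isT; rewrite /= !(rmorphB, rmorphM, rmorphXn) => /subr0_eq.
- apply: case4; [have := hn 1 isT | have := hn 2 isT | have := hn 3 isT | have := hn 4 isT];
  by rewrite /= !(rmorphB, rmorphM, mulrBr) => /subr0_eq.
- apply: case4; [have := hn 5 isT | have := hn 6 isT | have := hn 7 isT | have := hn 8 isT];
  by rewrite /= !(rmorphB, rmorphM, rmorphXn, mulrBr) => /subr0_eq.
have e i j : pi (cc i * cc j * (bb i - bb j)) = 0 -> 
  pi (cc i) * pi (cc j) * (pi (bb i) - pi (bb j)) = 0 /\
  pi (cc j) * pi (cc i) * (pi (bb j) - pi (bb i)) = 0.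
  rewrite !(rmorphB, rmorphM) => h1; split=> //.
  by rewrite -opprB mulrN [pi (cc j) * _]mulrC h1 oppr0.
have [e12 e21] := e 1 2 (hn 9 isT).
have [e13 e31] := e 1 3 (hn 10 isT).
have [e14 e41] := e 1 4 (hn 11 isT).
have [e23 e32] := e 2 3 (hn 12 isT).
have [e24 e42] := e 2 4 (hn 13 isT).
have [e34 e43] := e 3 4 (hn 14 isT).
by case=> [|[|[|[|[|i]]]]] [|[|[|[|[|j]]]]] // _ _; rewrite subrr mulr0.
Qed.

Lemma K_krel (A : comNzRingType) (pi : {rmorphism R -> A}) :
  (forall r, K r -> pi r = 0) -> Krel d (pi \o aa) (pi \o bb) (pi \o cc).
Proof.
move=> h.
have hK : {in K0_gens ++ K_gens, forall x, pi x = 0}.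
  by move=> x hx; apply/h/mem_ideal_gen; rewrite K2d_gens_cat.
have hn i : (i < size K_gens)%N -> pi K_gens`_i = 0.
  by move=> hi; apply: hK; rewrite mem_cat mem_nth ?orbT.
split => /=.
- by apply: K0_krel => x hx; apply: hK; rewrite mem_cat hx.
- by have := hn 0 isT; rewrite /= !(rmorphB, rmorphM, rmorphXn) => /subr0_eq.
- by have := hn 1 isT; rewrite /= !(rmorphB, rmorphM, rmorphXn) => /subr0_eq.
- by have := hn 2 isT; rewrite /= !(rmorphB, rmorphM, rmorphXn) mulrBr => /subr0_eq.
- by have := hn 3 isT; rewrite /= !(rmorphB, rmorphM, rmorphXn) mulrBr => /subr0_eq.
- have := hn 4 isT; rewrite /= !(rmorphB, rmorphM, rmorphXn) mulrBr => /subr0_eq.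
  by rewrite !mulrA.
Qed.

Lemma K0_min I : is_ideal I ->
  I (aa 1 * aa 3 ^+ d - aa 4 * aa 2 ^+ d) ->
  (forall i, (0 < i <= 4)%N ->
     I (cc i * (aa 2 - bb i * aa 3)) /\ I (cc i * (aa 1 - bb i ^+ d * aa 4))) ->
  (forall i j, (0 < i < j)%N -> (j <= 4)%N -> I (cc i * cc j * (bb i - bb j))) ->
  {in K0_gens, forall x, I x}.
Proof.
move=> idI h0 hp hb x; rewrite /K0_gens !mem_cat mem_seq1 => /or4P[/eqP -> //|||] /mapP[i].
- by rewrite mem_iota => hi ->; have [] := hp i hi.
- by rewrite mem_iota => hi ->; have [] := hp i hi.
rewrite mem_filter => /andP[hij /allpairsP[[u v] [hu hv e]]] ->.
move: hij hu hv; rewrite e !mem_iota /= => huv /andP[u0 _] /andP[_ v4].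
by apply: hb; rewrite ?u0.
Qed.

Lemma K_min I : is_ideal I ->
  I (aa 1 * aa 3 ^+ d - aa 4 * aa 2 ^+ d) ->
  (forall i, (0 < i <= 4)%N ->
     I (cc i * (aa 2 - bb i * aa 3)) /\ I (cc i * (aa 1 - bb i ^+ d * aa 4))) ->
  (forall i j, (0 < i < j)%N -> (j <= 4)%N -> I (cc i * cc j * (bb i - bb j))) ->
  foldr (fun x Q => I x /\ Q) True K_gens ->
  forall r, K r -> I r.
Proof.
move=> idI h0 hp hb hh r; apply: ideal_gen_min => // x; rewrite K2d_gens_cat mem_cat.
case/orP => [|hx]; first exact: K0_min.
by apply: (ideal_gen_foldr idI hh); apply: mem_ideal_gen.
Qed.

Lemma K0_min_hom (A : comNzRingType) (pi : {rmorphism R -> A}) :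
  Krel0 d (pi \o aa) (pi \o bb) (pi \o cc) -> {in K0_gens, forall r, pi r = 0}.
Proof.
case=> g0 p2 p1 pb; apply: (K0_min (ker_ideal pi)) => [|i hi|i j hij hj].
- by rewrite !(rmorphB, rmorphM, rmorphXn) (g0 : pi _ * pi _ ^+ _ = _) subrr.
- by split; rewrite !(rmorphB, rmorphM, rmorphXn) mulrBr ?(p2 _ hi : pi _ * pi _ = _)
    ?(p1 _ hi : pi _ * pi _ = _) subrr.
- have /andP[i0 ij] := hij; rewrite !(rmorphB, rmorphM); apply: pb.
    by rewrite i0 (leq_trans (ltnW ij)).
  by rewrite hj (leq_trans i0) // ltnW.
Qed.

Lemma K_min_hom (A : comNzRingType) (pi : {rmorphism R -> A}) :
  Krel d (pi \o aa) (pi \o bb) (pi \o cc) -> forall r, K r -> pi r = 0.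
Proof.
case=> h0 h1 h2 h3 h4 h5; apply: (ideal_gen_min (ker_ideal pi)).
move=> x; rewrite K2d_gens_cat mem_cat => /orP[hx|hx]; first exact: (K0_min_hom h0 hx).
apply: (@ideal_gen_foldr K_gens (fun r => pi r = 0) (ker_ideal pi)); last exact: mem_ideal_gen.
rewrite /=; split; last split; last split; last split; last split=> //;
  rewrite !(rmorphB, rmorphM, rmorphXn) ?mulrBr; apply/eqP; rewrite subr_eq0; apply/eqP => //.
by move: h5 => /=; rewrite !mulrA.
Qed.

(** * Substitutions and primary ideals *)

Definition divides x r := exists q, r = x * q.

Lemma divides_ideal x : is_ideal (divides x).
Proof.
split=> [|r s [p ->] [q ->]|r s [p ->]]; first by exists 0; rewrite mulr0.
  by exists (p + q); rewrite mulrDr.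
by exists (r * p); rewrite mulrCA.
Qed.

(** The projection to R/I is one of these morphisms. Membership thus becomes a calculation with
    equations in an arbitrary ring. *)
Lemma ideal_hom I r : is_ideal I ->
  (forall (A : comNzRingType) (pi : {rmorphism R -> A}),
     (forall s, I s -> pi s = 0) -> pi r = 0) -> I r.
Proof.
move=> idI h; case: (excluded_middle_informative (I 1)) => [I1|I1].
  by case: idI => _ _ hM; rewrite -[r]mulr1; apply: hM.
have [A [pi [hpi _]]] := quotient_exists idI I1.
by apply/hpi/h => s /hpi.
Qed.

(** Modulo [S] the substitution acts as the identity, so whatever it kills lies in the generated
    ideal. Candidate primes are recognised in this way as kernels of morphisms to a domain. *)
Lemma gen_ker S wa wb wc :
  foldr (fun g Q => sub wa wb wc g = 0 /\ Q) True S ->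
  (forall (A : comNzRingType) (pi : {rmorphism R -> A}),
     foldr (fun g Q => pi g = 0 /\ Q) True S ->
     forall i, (0 < i <= 4)%N ->
       [/\ pi (wa i) = pi (aa i), pi (wb i) = pi (bb i) & pi (wc i) = pi (cc i)]) ->
  forall r, ideal_gen S r <-> sub wa wb wc r = 0.
Proof.
move=> hS hpi r; split; first exact: (ideal_gen_foldr (ker_ideal _) hS).
move=> r0; apply: ideal_hom (ideal_gen_ideal S) _ => A pi kS.
have h := hpi A pi; rewrite -(hom_sub (h _)) ?r0 ?rmorph0 //.
have {}kS : {in S, forall x, pi x = 0} by move=> x /mem_ideal_gen /kS.
elim: {hS hpi r0 h} S kS => // x S IH kS; split; first by apply: kS; rewrite mem_head.
by apply: IH => y yS; apply: kS; rewrite inE yS orbT.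
Qed.

(* x generates the kernel of the retraction z *)
Definition divisor x (z : R -> R) :=
  [/\ x != 0, z x = 0 & forall r, exists q, r = z r + x * q].

Lemma divisor_sub x wa wb wc : x != 0 -> sub wa wb wc x = 0 ->
  (forall i, (0 < i <= 4)%N ->
     [/\ divides x (aa i - wa i), divides x (bb i - wb i) & divides x (cc i - wc i)]) ->
  divisor x (sub wa wb wc).
Proof.
move=> x0 zx h; split=> // r; have [q e] := sub_congr (divides_ideal x) h r.
by exists q; rewrite -e addrC subrK.
Qed.

Lemma divides_sub0 x r : divides x (r - r).
Proof. by exists 0; rewrite subrr mulr0. Qed.
Lemma divides_sub x : divides x (x - 0).
Proof. by exists 1; rewrite subr0 mulr1. Qed.
Hint Resolve divides_sub0 divides_sub : core.

Definition za4 : {rmorphism R -> R} := sub (four (aa 1) (aa 2) (aa 3) 0) bb cc.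
Definition za3 : {rmorphism R -> R} := sub (four (aa 1) (aa 2) 0 (aa 4)) bb cc.
Definition zb2 : {rmorphism R -> R} := sub aa (four (bb 1) 0 (bb 3) (bb 4)) cc.
Definition zb3 : {rmorphism R -> R} := sub aa (four (bb 1) (bb 2) 0 (bb 4)) cc.
Definition zc (n : nat) : {rmorphism R -> R} := sub aa bb (fun i => if i == n then 0 else cc i).
Definition zb12 : {rmorphism R -> R} := sub aa (four (bb 2) (bb 2) (bb 3) (bb 4)) cc.

Lemma za4P : divisor (aa 4) za4.
Proof. by apply: divisor_sub; rewrite ?aa_neq0 ?subst_aa //; four_cases. Qed.
Lemma za3P : divisor (aa 3) za3.
Proof. by apply: divisor_sub; rewrite ?aa_neq0 ?subst_aa //; four_cases. Qed.
Lemma zb2P : divisor (bb 2) zb2.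
Proof. by apply: divisor_sub; rewrite ?bb_neq0 ?subst_bb //; four_cases. Qed.
Lemma zb3P : divisor (bb 3) zb3.
Proof. by apply: divisor_sub; rewrite ?bb_neq0 ?subst_bb //; four_cases. Qed.
Lemma zcP n : (0 < n <= 4)%N -> divisor (cc n) (zc n).
Proof.
move=> hn; apply: divisor_sub; rewrite ?cc_neq0 ?subst_cc ?eqxx // => i hi.
by split=> //; case: eqP => [->|].
Qed.

Lemma bb12_neq0 : bb 1 - bb 2 != 0.
Proof.
apply/eqP => /(congr1 zb2); rewrite rmorphB rmorph0 /zb2 /= !subst_bb //= subr0.
by apply/eqP/bb_neq0.
Qed.

Lemma zb12P : divisor (bb 1 - bb 2) zb12.
Proof.
apply: divisor_sub; rewrite ?bb12_neq0 ?rmorphB /= ?subst_bb //= ?subrr //.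
by four_cases; split => //; exists 1; rewrite mulr1.
Qed.

Lemma divisor_ker x z r : divisor x z -> z r = 0 -> divides x r.
Proof. by case=> _ _ /(_ r) [q e] z0; exists q; rewrite e z0 add0r. Qed.

Section Primary.
Variables (phi z : {rmorphism R -> R}) (x : R).
Hypothesis xz : divisor x z.

Definition pideal n r := divides (x ^+ n) (phi r).

Lemma pideal_ideal n : is_ideal (pideal n).
Proof.
have [h0 hD hM] := divides_ideal (x ^+ n).
split=> [|r s hr hs|r s hs]; rewrite /pideal ?rmorph0 ?rmorphD ?rmorphM //.
  exact: hD.
exact: hM.
Qed.

Lemma pideal_ker n r : phi r = 0 -> pideal n r.
Proof. by move=> h; exists 0; rewrite h mulr0. Qed.

(** The element [x] is prime, because [z] embeds R/(x) in the domain R; if [x] does not divide [r],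
    its powers come off [f] one at a time. *)
Lemma divisorX_prime n r f : divides (x ^+ n) (r * f) -> z r = 0 \/ divides (x ^+ n) f.
Proof.
have [x0 zx _] := xz.
elim: n f => [|n IH] f; first by right; exists f; rewrite mul1r.
case=> q e; have /eqP : z r * z f = 0 by rewrite -rmorphM e rmorphM rmorphXn zx expr0n mul0r.
rewrite mulf_eq0 => /orP[/eqP|/eqP zf]; first by left.
have [f' ef] := divisor_ker xz zf.
case: (IH f'); [|by left | by case=> q' eq'; right; exists q'; rewrite ef eq' exprS mulrA].
by exists q; apply: (mulfI x0); rewrite [RHS]mulrA -exprS -e ef mulrCA.
Qed.

Lemma pideal_primary n r f : pideal n (r * f) -> z (phi r) = 0 \/ pideal n f.
Proof. by rewrite /pideal rmorphM => /divisorX_prime. Qed.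

Lemma pideal_cancel n r f : z (phi r) != 0 -> pideal n (r * f) -> pideal n f.
Proof. by move=> /eqP zr /pideal_primary []. Qed.
End Primary.

(** * Binomials generating the kernel of a substitution *)

Section Binomial.
Variables (x u y v t : R) (e : nat) (zx zy chi : {rmorphism R -> R}).
Variable eta : {rmorphism R -> {fraction R}}.
Local Notation g := (u * y - v * t).
Hypotheses (ux : u = x ^+ e) (xz : divisor x zx) (zg : zx g != 0) (chig : chi g = 0).
Hypotheses (zyC : forall c, zy c%:MP = c%:MP) (zys : zy (s2 k) = s2 k) (zyf : zy (f2 k) = f2 k).
Hypotheses (zyu : zy u = u) (zyvt : zy (v * t) = v * t).
Hypothesis zyv : forall i, (0 < i <= 4)%N ->
  [/\ zy (aa i) = aa i \/ aa i = y, zy (bb i) = bb i \/ bb i = y & zy (cc i) = cc i \/ cc i = y].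
Hypothesis etaP : forall r, eta (chi (zy r)) = FracField.tofrac (zy r).

Lemma binomial_reduce r : exists M r' w, u ^+ M * r = zy r' + g * w.
Proof.
have fixed p : zy p = p \/ p = y -> exists M r' w, u ^+ M * p = zy r' + g * w.
  case=> [hp|->]; first by exists 0%N, p, 0; rewrite hp; ring.
  by exists 1%N, (v * t), 1; rewrite zyvt; ring.
elim/mpoly_ring_ind: r => [c|||i /zyv [? ? ?]|p q|p q].
- by apply: fixed; left; apply: zyC.
- by apply: fixed; left.
- by apply: fixed; left.
- by split; apply: fixed.
- move=> [M [p' [w ep]]] [M' [q' [w' eq]]].
  exists (M + M')%N, (u ^+ M' * p' + u ^+ M * q'), (u ^+ M' * w + u ^+ M * w').
  rewrite rmorphD !rmorphM !rmorphXn zyu.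
  transitivity (u ^+ M' * (u ^+ M * p) + u ^+ M * (u ^+ M' * q)); first by rewrite exprD; ring.
  by rewrite ep eq; ring.
- move=> [M [p' [w ep]]] [M' [q' [w' eq]]].
  exists (M + M')%N, (p' * q'), (zy p' * w' + zy q' * w + g * w * w').
  rewrite rmorphM.
  transitivity ((u ^+ M * p) * (u ^+ M' * q)); first by rewrite exprD; ring.
  by rewrite ep eq; ring.
Qed.

(** Modulo [g] one has [u * y = v * t], so a power of [u] removes [y] from [r]. On polynomials
    without [y] the map [chi] is injective, [eta] being a left inverse into the fractions; hence
    [u ^+ M * r] is a multiple of [g]. As [u] is a power of the prime [x], which does not divide
    [g], that power cancels. *)
Lemma binomial_ker r : chi r = 0 -> divides g r.
Proof.
move=> r0; have [M [r' [w e1]]] := binomial_reduce r.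
have zr' : zy r' = 0.
  apply/eqP; rewrite -tofrac_eq0 -etaP.
  have := congr1 chi e1; rewrite rmorphD !rmorphM r0 chig mul0r addr0 mulr0 => <-.
  by rewrite rmorph0.
rewrite zr' add0r {1}ux -exprM in e1.
have [x0 zx0 _] := xz.
elim: (e * M)%N w e1 => [|n IH] w e1; first by exists w; rewrite -e1 mul1r.
have /eqP : zx g * zx w = 0 by rewrite -rmorphM -e1 rmorphM rmorphXn zx0 expr0n mul0r.
rewrite mulf_eq0 (negbTE zg) /= => /eqP /(divisor_ker xz) [w' ew].
by apply: (IH w'); apply: (mulfI x0); rewrite mulrA -exprS e1 ew mulrCA.
Qed.
End Binomial.

Hypothesis d_gt0 : (0 < d)%N.
Local Notation tofrac := (@FracField.tofrac R).

Lemma Ngt0 : (0 < N)%N. Proof. by rewrite expn_gt0 d_gt0. Qed.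
Lemma exprd0 (A : comNzRingType) : (0 : A) ^+ d = 0.
Proof. by rewrite expr0n eqn0Ngt d_gt0. Qed.

(** A parametrisation of the hypersurface [cc 2 * bb 1 = cc 3 * bb 4], as [chi2] is one of
    [aa 1 * aa 3 ^+ d = aa 4 * aa 2 ^+ d]. *)
Definition chi5 : {rmorphism R -> R} :=
  sub aa (four (cc 3 * bb 4) (bb 2) (bb 3) (cc 2 * bb 4)) cc.
Definition chi2 : {rmorphism R -> R} :=
  sub (four (aa 2 ^+ d * aa 4) (aa 2) (aa 3) (aa 3 ^+ d * aa 4)) bb cc.

Lemma chi5_ker r : chi5 r = 0 -> divides (cc 2 * bb 1 - cc 3 * bb 4) r.
Proof.
pose zy : {rmorphism R -> R} := sub aa (four 0 (bb 2) (bb 3) (bb 4)) cc.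
(* Dividing by [cc 2] undoes [chi5] on [bb 4], the one variable besides [bb 1] that it moves. *)
pose eta : {rmorphism R -> {fraction R}} := subst tofrac (tofrac \o aa)
  (four (tofrac (bb 1)) (tofrac (bb 2)) (tofrac (bb 3)) (tofrac (bb 4) / tofrac (cc 2)))
  (tofrac \o cc).
apply: (@binomial_ker (cc 2) (cc 2) (bb 1) (cc 3) (bb 4) 1 (zc 2) zy chi5 eta).
- by rewrite expr1.
- exact: zcP.
- rewrite rmorphB !rmorphM /zc /= !subst_cc // !subst_bb //= mul0r sub0r oppr_eq0.
  by rewrite mulf_neq0 ?cc_neq0 ?bb_neq0.
- by rewrite rmorphB !rmorphM /chi5 /= !subst_cc // !subst_bb //=; ring.
- by move=> c; rewrite /zy /= substC.
- by rewrite /zy /= subst_s2.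
- by rewrite /zy /= subst_f2.
- by rewrite /zy /= subst_cc.
- by rewrite rmorphM /zy /= subst_cc // subst_bb.
- by rewrite /zy /=; four_cases; rewrite subst_aa // subst_bb // subst_cc //=; split; auto.
move=> s; apply: (@hom_ext k _ (eta \o (chi5 \o zy)) (tofrac \o zy)) => [c|||] /=.
- by rewrite /zy /chi5 /eta /= !substC.
- by rewrite /zy /chi5 /eta /= !subst_s2.
- by rewrite /zy /chi5 /eta /= !subst_f2.
rewrite /zy /chi5 /eta /=; four_cases; rewrite !(subst_aa, subst_bb, subst_cc) //= ?rmorph0 //.
rewrite rmorphM /= !subst_bb //= subst_cc //=; split => //.
by rewrite mulrCA divff ?mulr1 // tofrac_eq0 cc_neq0.
Qed.

Lemma chi2_ker r : chi2 r = 0 -> divides (aa 1 * aa 3 ^+ d - aa 4 * aa 2 ^+ d) r.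
Proof.
rewrite [aa 1 * _]mulrC [aa 4 * _]mulrC.
pose zy : {rmorphism R -> R} := sub (four 0 (aa 2) (aa 3) (aa 4)) bb cc.
pose eta : {rmorphism R -> {fraction R}} := subst tofrac
  (four (tofrac (aa 1)) (tofrac (aa 2)) (tofrac (aa 3)) (tofrac (aa 4) / tofrac (aa 3 ^+ d)))
  (tofrac \o bb) (tofrac \o cc).
apply: (@binomial_ker (aa 3) (aa 3 ^+ d) (aa 1) (aa 2 ^+ d) (aa 4) d (za3) zy chi2 eta).
- by [].
- exact: za3P.
- rewrite rmorphB !rmorphM !rmorphXn /za3 /= !subst_aa //= exprd0 mul0r sub0r oppr_eq0.
  by rewrite mulf_neq0 ?expf_neq0 ?aa_neq0.
- by rewrite rmorphB !rmorphM !rmorphXn /chi2 /= !subst_aa //=; ring.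
- by move=> c; rewrite /zy /= substC.
- by rewrite /zy /= subst_s2.
- by rewrite /zy /= subst_f2.
- by rewrite rmorphXn /zy /= subst_aa.
- by rewrite rmorphM rmorphXn /zy /= !subst_aa.
- by rewrite /zy /=; four_cases; rewrite subst_aa // subst_bb // subst_cc //=; split; auto.
move=> s; apply: (@hom_ext k _ (eta \o (chi2 \o zy)) (tofrac \o zy)) => [c|||] /=.
- by rewrite /zy /chi2 /eta /= !substC.
- by rewrite /zy /chi2 /eta /= !subst_s2.
- by rewrite /zy /chi2 /eta /= !subst_f2.
rewrite /zy /chi2 /eta /=; four_cases; rewrite !(subst_aa, subst_bb, subst_cc) //= ?rmorph0 //.
rewrite rmorphM rmorphXn /= !subst_aa //=; split => //.
by rewrite mulrCA -rmorphXn /= divff ?mulr1 // tofrac_eq0 expf_neq0 ?aa_neq0.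
Qed.

(** The kernels of [phi2], [phi17], [phi20] and, when [alpha ^+ d = 1], [phi19 alpha] are the primes
    themselves. In contrast [phi3] and [phi5] leave [bb 3], respectively [bb 2], free: setting that
    variable to zero gives the prime, and divisibility by its power N the primary ideal. *)
Definition phi2 : {rmorphism R -> R} :=
  sub (four (aa 2 ^+ d * aa 4) (aa 2) (aa 3) (aa 3 ^+ d * aa 4)) bb (fun=> 0).
Definition phi3 : {rmorphism R -> R} :=
  sub (four (bb 3 ^+ d * aa 4) (bb 3 * aa 3) (aa 3) (aa 4))
      (four (bb 1) (bb 2) (bb 3) 0) (four 0 0 (cc 3) 0).
Definition psi5 : {rmorphism R -> R} :=
  sub (four (bb 2 ^+ d * aa 4) (bb 2 * aa 3) (aa 3) (aa 4))
      (four (bb 1) (bb 2) (bb 2) (bb 4)) (four 0 (cc 2) (cc 3) 0).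
Definition phi5 : {rmorphism R -> R} :=
  sub (four (bb 2 ^+ d * aa 4) (bb 2 * aa 3) (aa 3) (aa 4))
      (four (cc 3 * bb 4) (bb 2) (bb 2) (cc 2 * bb 4)) (four 0 (cc 2) (cc 3) 0).
Definition phi17 : {rmorphism R -> R} :=
  sub (four (bb 2 ^+ d * aa 4) (bb 2 * aa 3) (aa 3) (aa 4)) (fun=> bb 2)
      (four (bb 2 ^+ N * cc 2) (cc 2) (cc 2) (bb 2 ^+ N * cc 2)).
Definition phi20 : {rmorphism R -> R} :=
  sub (fun=> 0) (four (bb 1) (bb 2) (bb 2) (bb 1)) (fun=> 0).
Definition phi19 (alpha : k) : {rmorphism R -> R} :=
  sub (four (bb 1 ^+ d * aa 4) 0 0 (aa 4))
      (four (bb 1) (alpha *: bb 1) (alpha *: bb 1) (bb 1)) (fun=> 0).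

Definition J3 := pideal phi3 (bb 3).
Definition J5 := pideal phi5 (bb 2).

Lemma phi5E r : phi5 r = chi5 (psi5 r).
Proof.
rewrite /phi5 /chi5 /psi5 /=; symmetry; apply: sub_sub.
by four_cases; rewrite ?rmorphM ?rmorphXn ?rmorph0 /= !(subst_aa, subst_bb, subst_cc) //=.
Qed.

(* chi5 kills c12 b11 - c13 b14 and fixes b12, so powers of b12 can be divided out one
   at a time. *)
Lemma chi5_gen n h : divides (bb 2 ^+ n) (chi5 h) ->
  exists u v, h = bb 2 ^+ n * u + (cc 2 * bb 1 - cc 3 * bb 4) * v.
Proof.
elim: n h => [|n IH] h [q e]; first by exists h, 0; rewrite mul1r mulr0 addr0.
have [b20 zb20 hz] := zb2P.
(* By this commutation [chi5] kills the part of [h] free of [bb 2], which is therefore a multiple of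
   the binomial. *)
have comm : zb2 (chi5 h) = chi5 (zb2 h).
  rewrite /zb2 /chi5 /=; transitivity (sub aa (four (cc 3 * bb 4) 0 (bb 3) (cc 2 * bb 4)) cc h).
    apply: sub_sub; four_cases;
    by rewrite ?rmorphM /= !(subst_aa, subst_bb, subst_cc).
  symmetry; apply: sub_sub; four_cases;
  by rewrite ?rmorph0 ?rmorphM /= !(subst_aa, subst_bb, subst_cc).
have [w ew] : divides (cc 2 * bb 1 - cc 3 * bb 4) (zb2 h).
  by apply: chi5_ker; rewrite -comm e rmorphM rmorphXn zb20 expr0n mul0r.
have [h1 eh1] := hz h.
have [|u [v euv]] := IH h1.
  exists q; apply: (mulfI b20); rewrite mulrA -exprS -e eh1 ew.
  by rewrite /chi5; hom; ring.
exists u, (w + bb 2 * v); rewrite eh1 ew euv exprS; ring.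
Qed.

Lemma J5_gen n r : J5 n r ->
  exists u v, psi5 r = bb 2 ^+ n * u + (cc 2 * bb 1 - cc 3 * bb 4) * v.
Proof. by rewrite /J5 /pideal phi5E => /chi5_gen. Qed.

(** * The candidate primes as kernels of substitutions *)

Lemma Q17P r : @Q17_2 k d r <-> phi17 r = 0.
Proof.
rewrite /Q17_2 -(vaE k) -(vbE k) -(vcE k) /phi17 /=; apply: gen_ker.
  rewrite /=; do !split; hom; ring.
move=> A pi /= [h1 [h2 [h3 [h4 [h5 [h6 [h7 [h8 [h9 _]]]]]]]]].
move: h1 h2 h3 h4 h5 h6 h7 h8 h9; hom.
move=> /subr0_eq h1 _ /subr0_eq h3 /subr0_eq h4 /subr0_eq h5 /subr0_eq h6 /subr0_eq h7.
move=> /subr0_eq h8 /subr0_eq h9.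
by four_cases; hom; rewrite ?h9 ?h8 ?h7 ?h6 ?h5 -?h1 -?h3 -?h4.
Qed.

Lemma Q20P r : @Q20 k r <-> phi20 r = 0.
Proof.
rewrite /Q20 /C1_gens -(vaE k) -(vbE k) -(vcE k) /phi20 /=; apply: gen_ker.
  rewrite /=; do !split; hom; ring.
move=> A pi /= [c1 [c2 [c3 [c4 [h1 [h2 [a1 [a2 [a3 [a4 _]]]]]]]]]].
move: h1 h2; hom => /subr0_eq h1 /subr0_eq h2.
by four_cases; hom; rewrite ?c1 ?c2 ?c3 ?c4 ?h1 ?h2 ?a1 ?a2 ?a3 ?a4.
Qed.

Lemma Q19P alpha r : alpha ^+ d = 1 -> @Q19_2_1 k d alpha r <-> phi19 alpha r = 0.
Proof.
move=> ha; have haP : (alpha%:MP_[14]) ^+ d = 1 :> R by rewrite -rmorphXn ha rmorph1.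
rewrite /Q19_2_1 /C1_gens -(vaE k) -(vbE k) -(vcE k) /phi19 /=; apply: gen_ker.
  rewrite /=; do !split; rewrite -?mul_mpolyC; hom; rewrite ?substC /= ?exprMn ?haP; ring.
move=> A pi /= [c1 [c2 [c3 [c4 [h1 [h2 [a2 [a3 [h3 [h4 _]]]]]]]]]].
move: h1 h2 h3 h4; rewrite -mul_mpolyC; hom => /subr0_eq h1 /subr0_eq h2 /subr0_eq h3 /subr0_eq h4.
have haA : pi (alpha%:MP_[14]) ^+ d = 1 by rewrite -rmorphXn haP rmorph1.
four_cases; rewrite -?mul_mpolyC; hom; rewrite ?c1 ?c2 ?c3 ?c4 ?a2 ?a3 ?h1 -?h2 -?h4 ?h1 //.
  by rewrite h3 h4 exprMn haA mul1r h1.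
all: by rewrite -h1 -h4.
Qed.

(** Modulo the ideal [phi2] is not the identity, since it rescales [aa 4]. It is split into [psi2],
    which drops the [cc i], followed by [chi2], whose kernel is known. *)
Lemma Q2P r : @Q2 k d r <-> phi2 r = 0.
Proof.
rewrite /Q2 /C1_gens -(vaE k) -(vcE k); split.
  apply: (ideal_gen_foldr (ker_ideal _)); rewrite /phi2 /=; do !split; hom; ring.
pose psi2 : {rmorphism R -> R} := sub aa bb (fun=> 0).
have -> : phi2 r = chi2 (psi2 r).
  rewrite /phi2 /chi2 /psi2 /=; symmetry; apply: sub_sub.
  by four_cases; hom.
move=> /(chi2_ker) [w ew].
apply: ideal_hom (ideal_gen_ideal _) _ => A pi kS.
rewrite -(_ : pi (psi2 r) = pi r).
  rewrite ew rmorphM kS ?mul0r //; apply: mem_ideal_gen.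
  by rewrite mem_cat mem_seq1 eqxx orbT.
rewrite /psi2 /=; apply: hom_sub => i hi; split=> //; rewrite rmorph0; apply/esym/kS/mem_ideal_gen.
by case: i hi => [|[|[|[|[|i]]]]] // _; rewrite !inE eqxx ?orbT.
Qed.

Lemma Q3P r : @Q3 k r <-> zb3 (phi3 r) = 0.
Proof.
rewrite /Q3 -(vaE k) -(vbE k) -(vcE k).
have e : zb3 \o phi3 =1 sub (four 0 0 (aa 3) (aa 4)) (four (bb 1) (bb 2) 0 0) (four 0 0 (cc 3) 0).
  move=> s; rewrite /zb3 /phi3 /=; apply: sub_sub.
  by four_cases; hom; rewrite ?(exprd0) ?mul0r.
rewrite -[zb3 _]/((zb3 \o phi3) r) e; apply: gen_ker.
  rewrite /=; do !split; hom; rewrite ?(exprd0); ring.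
move=> A pi /= [c1 [c2 [c4 [a1 [a2 [b3 [b4 _]]]]]]].
by four_cases; hom; rewrite ?c1 ?c2 ?c4 ?a1 ?a2 ?b3 ?b4.
Qed.

Lemma Q5P r : @Q5 k r <-> zb2 (phi5 r) = 0.
Proof.
rewrite /Q5 -(vaE k) -(vbE k) -(vcE k); split.
  apply: (ideal_gen_foldr (ker_ideal (zb2 \o phi5))); rewrite /phi5 /zb2 /=.
  by do !split; hom; hom; rewrite ?(exprd0); ring.
move=> /(divisor_ker (zb2P)) h.
have [u [v euv]] := J5_gen (h : J5 1 r).
apply: ideal_hom (ideal_gen_ideal _) _ => A pi kS.
have kn i hi := kS _ (@ideal_gen_mem k _ i hi).
have := (kn 0 isT, kn 1 isT, (kn 2 isT, kn 3 isT), (kn 4 isT, kn 5 isT, kn 6 isT)).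
case=> -[[c1 c4] [a1 a2]] [[b2 b3] g].
rewrite /= in c1 c4 a1 a2 b2 b3 g.
rewrite -(_ : pi (psi5 r) = pi r).
  by rewrite euv rmorphD !rmorphM g b2 !mul0r addr0.
rewrite /psi5 /=; apply: hom_sub.
by four_cases; hom; rewrite ?c1 ?c4 ?a1 ?a2 ?b2 ?b3 ?(exprd0) ?mul0r.
Qed.

(** * Prime and primary ideals containing K *)

Lemma K_phi17 r : K r -> phi17 r = 0.
Proof.
apply: K_min_hom; rewrite /phi17; split=> [|||||]; first split; rewrite /=.
- by hom; rewrite exprMn; ring.
- by four_cases; hom; ring.
- by four_cases; hom; ring.
- by move=> i j hi hj; rewrite !subst_bb // subrr mulr0.
- by hom; rewrite exprMn exprN; ring.
- by hom; rewrite exprMn exprN; ring.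
- by hom.
- by hom.
- by hom.
Qed.

Lemma K_phi2 r : K r -> phi2 r = 0.
Proof.
apply: K_min_hom; rewrite /phi2; split=> [|||||]; first split; rewrite /=.
- by hom; ring.
- by move=> i hi; rewrite subst_cc // !mul0r.
- by move=> i hi; rewrite subst_cc // !mul0r.
- by move=> i j hi hj; rewrite subst_cc // !mul0r.
all: by rewrite !subst_vars ?mul0r !mulr0.
Qed.

(** The exponent N is that of [bb 3] in the image of [aa 1 ^+ d]. *)
Lemma K_J3 r : K r -> J3 N r.
Proof.
apply: (K_min (pideal_ideal (phi3) (bb 3) N)) => [|i hi|i j /andP[i0 ij] j4|].
- by apply: pideal_ker; rewrite /phi3; hom; rewrite exprMn; ring.
- split; apply: pideal_ker; rewrite /phi3;
  by case: i hi => [|[|[|[|[|i]]]]] // _; hom; ring.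
- apply: pideal_ker; rewrite /phi3.
  by case: i j i0 ij j4 => [|[|[|[|[|i]]]]] [|[|[|[|[|j]]]]] // _ _ _; hom; ring.
rewrite /=; do !split; rewrite /J3 /pideal /phi3 /divides; hom; rewrite ?exprMn -?exprN.
- by exists 0; ring.
- by exists (- (aa 4 ^+ d * cc 3)); ring.
- by exists (- (aa 4 ^+ d * cc 3)); ring.
- by exists 0; ring.
- by exists 0; ring.
Qed.

Lemma K_J5 r : K r -> J5 N r.
Proof.
apply: (K_min (pideal_ideal (phi5) (bb 2) N)) => [|i hi|i j /andP[i0 ij] j4|].
- by apply: pideal_ker; rewrite /phi5; hom; rewrite exprMn; ring.
- split; apply: pideal_ker; rewrite /phi5;
  by case: i hi => [|[|[|[|[|i]]]]] // _; hom; ring.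
- apply: pideal_ker; rewrite /phi5.
  by case: i j i0 ij j4 => [|[|[|[|[|i]]]]] [|[|[|[|[|j]]]]] // _ _ _; hom; ring.
rewrite /=; do !split; rewrite /J5 /pideal /phi5 /divides; hom; rewrite ?exprMn -?exprN.
- by exists (- (aa 4 ^+ d * cc 2)); ring.
- by exists (- (aa 4 ^+ d * cc 3)); ring.
- by exists (aa 4 ^+ d * (cc 2 - cc 3)); ring.
- by exists 0; ring.
- by exists 0; ring.
Qed.

(** The generators do not involve [x]. Each coefficient is its image under [z] plus a multiple of
    [x]; applying [z] to the relation shows that the first parts contribute zero, and [x] cancels
    from the rest. *)
Lemma reg_gen S x z r : divisor x (z : {rmorphism R -> R}) -> {in S, forall g, z g = g} ->
  ideal_gen S (x * r) -> ideal_gen S r.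
Proof.
case=> x0 zx hz zS [u e]; have /fin_all_exists [q hq] := fun j => hz (u j).
exists q; apply: (mulfI x0); rewrite mulr_sumr e.
have : z (x * r) = 0 by rewrite rmorphM zx mul0r.
rewrite e rmorph_sum /= => z0; rewrite -[LHS]subr0 -[X in _ - X = _]z0 -sumrB.
by apply: eq_bigr => i _; rewrite rmorphM (zS S`_i) ?mem_nth // {1}hq; ring.
Qed.

Lemma gen_stable S (z : {rmorphism R -> R}) r : {in S, forall g, z g = g} ->
  ideal_gen S r -> ideal_gen S (z r).
Proof.
move=> zS [u ->]; exists (fun i => z (u i)); rewrite rmorph_sum /=.
by apply: eq_bigr => i _; rewrite rmorphM (zS S`_i) ?mem_nth.
Qed.

(** * The ideal generated by b04^d and K0 *)

Definition Kx := ideal_gen (aa 4 ^+ d :: K0_gens).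

(** Next to [cc i], [aa 1 ^+ d] is a multiple of [aa 4 ^+ d] modulo [K0_gens]. *)
Lemma K_Kx r : K r -> Kx r.
Proof.
move=> Kr; apply: ideal_hom (ideal_gen_ideal _) _ => A pi kT.
have h0 : Krel0 d (pi \o aa) (pi \o bb) (pi \o cc).
  by apply: K0_krel => x hx; apply/kT/mem_ideal_gen; rewrite inE hx orbT.
have x0 : pi (aa 4) ^+ d = 0 by rewrite -rmorphXn; apply/kT/mem_ideal_gen; rewrite mem_head.
have cx i : (0 < i <= 4)%N -> pi (aa 1) ^+ d * pi (cc i) = 0.
  move=> hi; rewrite mulrC (mulr_congrX _ (krel_p1 h0 hi)) exprMn /= x0 !mulr0.
  by [].
apply: K_min_hom Kr; split=> //=; rewrite ?x0 ?mul0r ?cx //.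
Qed.

Section Slice.
Variable i : nat.
Hypothesis hi : (0 < i <= 4)%N.

(* Multiplying by c1 i identifies R / slice_gens with the part of R / Kx which is
   divisible by c1 i; the generators do not involve c1 i. *)
Definition slice_gens : seq R :=
  [:: aa 4 ^+ d; aa 2 - bb i * aa 3; aa 1 - bb i ^+ d * aa 4] ++
  [seq cc j * (bb i - bb j) | j <- iota 1 4 & j != i].

Lemma slice_fixed : {in slice_gens, forall g, zc i g = g}.
Proof.
move=> g; rewrite mem_cat !inE => /orP[/or3P[]/eqP ->|/mapP[j]].
- by rewrite /zc; hom.
- by rewrite /zc; hom; rewrite subst_bb // subst_aa.
- by rewrite /zc; hom; rewrite subst_bb // subst_aa.
rewrite mem_filter mem_iota => /andP[/negbTE ji hj] ->.
by rewrite /zc; hom; rewrite !subst_bb // subst_cc // ji.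
Qed.

Lemma Kx_slice r : Kx r -> ideal_gen slice_gens r.
Proof.
move=> Tr; apply: ideal_hom (ideal_gen_ideal _) _ => A pi kS.
have km g : g \in slice_gens -> pi g = 0 by move=> /mem_ideal_gen /kS.
have x0 : pi (aa 4) ^+ d = 0 by rewrite -rmorphXn; apply: km; rewrite mem_head.
have e2 : pi (aa 2) = pi (bb i) * pi (aa 3).
  by apply/subr0_eq; rewrite -rmorphM -rmorphB; apply: km; rewrite !inE eqxx orbT.
have e1 : pi (aa 1) = pi (bb i) ^+ d * pi (aa 4).
  apply/subr0_eq; rewrite -rmorphXn -rmorphM -rmorphB; apply: km; rewrite !inE eqxx.
  by rewrite !orbT.
have eb j : (0 < j <= 4)%N -> pi (cc j) * pi (bb i) = pi (cc j) * pi (bb j).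
  move=> hj; have [->//|ji] := eqVneq j i.
  apply/subr0_eq; rewrite -mulrBr -rmorphB -rmorphM; apply: km; rewrite mem_cat.
  apply/orP; right; apply/mapP; exists j => //.
  by rewrite mem_filter ji mem_iota.
apply: (ideal_gen_min (ker_ideal pi) _ Tr) => x; rewrite inE => /orP[/eqP ->|].
  by rewrite rmorphXn x0.
apply: K0_min_hom; split => /= [|j hj|j hj|j l hj hl].
- by rewrite e1 e2 exprMn; ring.
- by rewrite e2 !mulrA eb.
- by rewrite e1 !mulrA (mulr_congrX _ (eb j hj)).
- transitivity (pi (cc l) * (pi (cc j) * pi (bb j)) - pi (cc j) * (pi (cc l) * pi (bb l))); first by ring.
  by rewrite -!eb //; ring.
Qed.

Lemma slice_Kx r : ideal_gen slice_gens r -> Kx (cc i * r).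
Proof.
move=> Sr; apply: ideal_hom (ideal_gen_ideal _) _ => A pi kT.
have h0 : Krel0 d (pi \o aa) (pi \o bb) (pi \o cc).
  by apply: K0_krel => x hx; apply/kT/mem_ideal_gen; rewrite inE hx orbT.
have x0 : pi (aa 4) ^+ d = 0 by rewrite -rmorphXn; apply/kT/mem_ideal_gen; rewrite mem_head.
suff : forall s, ideal_gen slice_gens s -> pi (cc i * s) = 0 by apply.
apply: ideal_gen_min => [|g].
  split=> [|u v hu hv|u v hv]; first by rewrite mulr0 rmorph0.
    by rewrite mulrDr rmorphD hu hv addr0.
  by rewrite mulrCA rmorphM hv mulr0.
rewrite mem_cat !inE => /orP[/or3P[]/eqP ->|/mapP[j]].
- by rewrite rmorphM rmorphXn x0 mulr0.
- by rewrite rmorphM rmorphB rmorphM mulrBr; apply/eqP; rewrite subr_eq0; apply/eqP/(krel_p2 h0).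
- rewrite rmorphM rmorphB rmorphM rmorphXn mulrBr; apply/eqP; rewrite subr_eq0; apply/eqP.
  exact: (krel_p1 h0).
rewrite mem_filter mem_iota => /andP[_ hj] ->.
by rewrite mulrA !rmorphM rmorphB; apply: (krel_bb h0).
Qed.

(** The ideal of [slice_gens] is the colon ideal of [Kx] by [cc i]; it is stable under [zc i], and
    [cc i] is regular modulo it. It contains [f], hence [f - zc i f = cc i * q], hence [q], and so
    [cc i * q] lies in [Kx]. *)
Lemma Kx_split f : Kx (cc i * f) -> Kx (f - zc i f).
Proof.
move=> /Kx_slice h; have hz := zcP hi.
have Sf := reg_gen hz slice_fixed h.
have [q e] : divides (cc i) (f - zc i f).
  have [_ zi _] := hz; apply: (divisor_ker hz); rewrite rmorphB.
  by have [_ _ /(_ f)[q e]] := hz; rewrite {1}e rmorphD rmorphM zi mul0r addr0 subrr.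
rewrite e; apply: slice_Kx; apply: (reg_gen hz slice_fixed); rewrite -e.
by apply: (idealB (ideal_gen_ideal _)) => //; apply: gen_stable slice_fixed _.
Qed.
End Slice.

Local Notation x := (aa 4 ^+ d).

Definition zs (s : seq nat) : {rmorphism R -> R} :=
  sub aa bb (fun i => if i \in s then 0 else cc i).

Lemma zs_cons i s r : zs (i :: s) r = zc i (zs s r).
Proof.
rewrite /zs /zc /=; symmetry; apply: sub_sub => j hj.
rewrite subst_aa // subst_bb //; split=> //; rewrite inE.
by case: (j \in s); rewrite ?orbT ?rmorph0 // subst_cc // orbF.
Qed.

Lemma zs_nil r : zs [::] r = r.
Proof. by rewrite /zs /=; apply: (hom_sub (pi := idfun)). Qed.

Lemma Kx_zs s f : (forall i, i \in s -> (0 < i <= 4)%N) ->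
  (forall i, i \in s -> Kx (cc i * f)) -> Kx (f - zs s f).
Proof.
have idT : is_ideal Kx := ideal_gen_ideal _.
have [T0 TD TM] := idT.
elim: s => [|i s IH] hs hT; first by rewrite zs_nil subrr.
have Ts : Kx (f - zs s f).
  by apply: IH => j js; [apply: hs | apply: hT]; rewrite inE js orbT.
rewrite zs_cons -(subrKA (zs s f)); apply: TD => //.
apply: Kx_split; first by apply: hs; rewrite mem_head.
apply/(@ideal_congr Kx (cc i * f) _ idT); last by apply: hT; rewrite mem_head.
by rewrite -mulrBr; apply: TM.
Qed.

(** * The ideal K + (e) *)

Definition Ke r := exists u, K (r - x * cc 1 * u).

Lemma Ke_ideal : is_ideal Ke.
Proof.
have [K0 KD KM] := ideal_gen_ideal (@K2d_gens k d).
split=> [|r s [u hu] [v hv]|r s [u hu]]; first by exists 0; rewrite mulr0 subr0.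
  exists (u + v); rewrite (_ : _ - _ = (r - x * cc 1 * u) + (s - x * cc 1 * v)); last by ring.
  exact: KD.
exists (r * u); rewrite (_ : _ - _ = r * (s - x * cc 1 * u)); last by ring.
exact: KM.
Qed.

Lemma ideal_gen_nil r : @ideal_gen k [::] r -> r = 0.
Proof. by case=> u ->; rewrite big_ord0. Qed.

Lemma Q2_split r : phi2 r = 0 -> exists t1 t2 t3 t4 t0,
  r = cc 1 * t1 + cc 2 * t2 + cc 3 * t3 + cc 4 * t4 + (aa 1 * aa 3 ^+ d - aa 4 * aa 2 ^+ d) * t0.
Proof.
move=> /(Q2P); rewrite /Q2 /C1_gens -(vaE k) -(vcE k) /=.
move=> /ideal_gen_cons [t1] /ideal_gen_cons [t2] /ideal_gen_cons [t3] /ideal_gen_cons [t4].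
move=> /ideal_gen_cons [t0] /ideal_gen_nil h.
by exists t1, t2, t3, t4, t0; apply/subr0_eq; rewrite -h; ring.
Qed.

(** Modulo K + (e), [x] kills [cc 1] and [cc 4], so [x * t] only retains its terms in [cc 2] and
    [cc 3]. Membership in [J3 N] turns the second into a multiple of [x * cc 2]. Then
    [x * t = x * cc 2 * u] with [u] in [J5 N], and this vanishes because [x] kills both
    [cc 2 * bb 2 ^+ N] and the binomial of Q5. *)
Lemma Ke_of_primary t : phi2 t = 0 -> J3 N t -> J5 N t -> Ke (x * t).
Proof.
move=> /Q2_split [t1 [t2 [t3 [t4 [t0 et]]]]] J3t J5t.
have idF := Ke_ideal.
case: (excluded_middle_informative (Ke 1)) => [F1|F1].
  by case: idF => _ _ hM; rewrite -[_ * _]mulr1; apply: hM.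
have [A [pi [hpi _]]] := quotient_exists idF F1.
have hK : Krel d (pi \o aa) (pi \o bb) (pi \o cc).
  by apply: K_krel => r Kr; apply/hpi; exists 0; rewrite mulr0 subr0.
have e0 : pi (aa 4) ^+ d * pi (cc 1) = 0.
  rewrite -rmorphXn -rmorphM; apply/hpi; exists 1; rewrite mulr1 subrr.
  by have [] := ideal_gen_ideal (@K2d_gens k d).
have [/= xc1 xc4 xc2 xc3] := krel_mod_e hK e0.
have J3t3 : J3 N t3.
  have h : J3 N (cc 3 * t3).
    move: J3t; rewrite et /J3 /pideal => -[q hq]; exists q; rewrite -hq /phi3; hom.
    by rewrite exprMn; ring.
  apply: (pideal_cancel (zb3P)) h.
  by rewrite /phi3 /zb3; hom; hom; rewrite cc_neq0.
have [u3 eu3] : exists u, pi (x * cc 3 * t3) = pi (x * cc 2 * u).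
  (* Modulo [I], [t3] is congruent to [phi3 t3], a multiple of [bb 3 ^+ N], and [bb 3 ^+ N] itself
     lies in [I]. *)
  pose I r := exists u, pi (x * cc 3 * r) = pi (x * cc 2 * u).
  have idI : is_ideal I.
    split=> [|r s [u hu] [v hv]|r s [u hu]]; first by exists 0; rewrite !mulr0.
      by exists (u + v); rewrite !mulrDr !rmorphD hu hv.
    by exists (r * u); rewrite mulrCA rmorphM hu -rmorphM mulrCA.
  have I0 r : pi (x * cc 3 * r) = 0 -> I r by move=> h; exists 0; rewrite h mulr0 rmorph0.
  have hI : I (t3 - phi3 t3).
    rewrite /phi3 /=; apply: sub_congr => //.
    have I00 r : I (r - r) by apply: I0; rewrite subrr mulr0 rmorph0.
    four_cases; split=> //=; rewrite ?subr0.
    - apply: I0; hom; rewrite -mulrA mulrBr.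
      by have /= -> := @krel_p1 _ _ _ _ _ hK 3 isT; rewrite subrr mulr0.
    - by apply: I0; hom; rewrite mulrAC xc1 mul0r.
    - apply: I0; hom; rewrite -mulrA mulrBr.
      by have /= -> := @krel_p2 _ _ _ _ _ hK 3 isT; rewrite subrr mulr0.
    - by exists (cc 3); hom; rewrite mulrAC.
    - by exists (bb 1); hom; rewrite -!mulrA; have /= -> := krel_h4 hK.
    - by apply: I0; hom; rewrite mulrAC xc4 mul0r.
  apply/(ideal_congr idI hI).
  have [q eq] := J3t3; rewrite eq mulrC; case: idI => _ _; apply; apply: I0; hom.
  by rewrite -mulrA xc3.
pose u := t2 + u3.
have ext : pi (x * t) = pi (x * cc 2 * u).
  have /= g0 : pi (aa 1) * pi (aa 3) ^+ d = pi (aa 4) * pi (aa 2) ^+ d := krel_g0 hK.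
  transitivity (pi (x * cc 1) * pi t1 + pi (x * cc 2 * t2) + pi (x * cc 3 * t3) +
    pi (x * cc 4) * pi t4 + pi (aa 1 * aa 3 ^+ d - aa 4 * aa 2 ^+ d) * pi (x * t0)).
    by rewrite et; hom; ring.
  by rewrite eu3 /u; hom; rewrite xc1 xc4 g0; ring.
have J5u : J5 N u.
  have : J5 N (x * t - x * cc 2 * u).
    have /hpi [v /K_J5 [q hq]] : pi (x * t - x * cc 2 * u) = 0 by rewrite rmorphB ext subrr.
    exists q; rewrite -hq !rmorphB [phi5 (_ * v)]rmorphM.
    by rewrite (_ : phi5 (x * cc 1) = 0) ?mul0r ?subr0 // /phi5; hom; rewrite mulr0.
  have idJ : is_ideal (J5 N) := pideal_ideal (phi5) (bb 2) N.
  move=> hJ; have [h _] := ideal_congr idJ hJ.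
  have JM r s : J5 N s -> J5 N (r * s) by case: idJ => _ _; apply.
  have {h} : J5 N (x * cc 2 * u) := h (JM _ _ J5t).
  apply: (pideal_cancel (zb2P)).
  by rewrite /phi5 /zb2; hom; hom; rewrite mulf_neq0 ?expf_neq0 ?aa_neq0 ?cc_neq0.
apply/hpi; rewrite ext.
have idI : is_ideal (fun r => pi (x * cc 2 * r) = 0).
  split=> [|r s hr hs|r s hs]; first by rewrite mulr0 rmorph0.
    by rewrite mulrDr rmorphD hr hs addr0.
  by rewrite mulrCA rmorphM hs mulr0.
have hI : pi (x * cc 2 * (u - psi5 u)) = 0.
  rewrite /psi5 /=; apply: (sub_congr idI).
  have I00 r : pi (x * cc 2 * (r - r)) = 0 by rewrite subrr mulr0 rmorph0.
  four_cases; split=> //=; rewrite ?subr0.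
  - hom; rewrite -mulrA mulrBr.
    by have /= -> := @krel_p1 _ _ _ _ _ hK 2 isT; rewrite subrr mulr0.
  - by hom; rewrite mulrAC xc1 mul0r.
  - hom; rewrite -mulrA mulrBr.
    by have /= -> := @krel_p2 _ _ _ _ _ hK 2 isT; rewrite subrr mulr0.
  - by hom; rewrite mulrBr -!mulrA; have /= -> := krel_h5 hK; rewrite subrr.
  - by hom; rewrite mulrAC xc4 mul0r.
apply/(ideal_congr idI hI); have [v [w ->]] := J5_gen J5u.
have h4 : pi (x * (cc 2 * bb 1 - cc 3 * bb 4)) = 0.
  by hom; rewrite mulrBr; have /= -> := krel_h4 hK; rewrite subrr.
transitivity (pi (x * (cc 2 * bb 2 ^+ N)) * pi v +
  pi (x * (cc 2 * bb 1 - cc 3 * bb 4)) * pi (cc 2 * w)).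
  by rewrite -!rmorphM -rmorphD; congr (pi _); ring.
by rewrite h4 rmorphM rmorphXn rmorphM rmorphXn xc2; ring.
Qed.

(** * Associated primes not containing all the c1 i *)

Section PrimeCase.
Variables (P : R -> Prop) (f : R).
Hypotheses (primeP : is_prime_ideal P) (Pf : same_ideal P (colon K f)).

Lemma prime_ideal : is_ideal P. Proof. by case: primeP. Qed.
Let idP := prime_ideal.

Lemma primeM r s : P (r * s) -> P r \/ P s.
Proof. by case: primeP => _ _ _ _; apply. Qed.

Lemma primeX r n : P (r ^+ n) -> P r.
Proof.
elim: n => [|n IH]; first by case: primeP => _ _ _ P1 _ /P1.
by rewrite exprS => /primeM[|/IH].
Qed.

Lemma primeMl r s : P r -> P (s * r).
Proof. by case: idP => _ _; apply. Qed.

Lemma primeMr r s : P r -> P (r * s).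
Proof. by rewrite mulrC; apply: primeMl. Qed.

Lemma primeXr r n : (0 < n)%N -> P r -> P (r ^+ n).
Proof. by case: n => // n _ h; rewrite exprS; apply: primeMr. Qed.

Lemma not_colon : ~ K f.
Proof.
by case: primeP => _ _ _ P1 _ Kf; apply/P1/Pf; rewrite /colon mul1r.
Qed.

Lemma K_sub_P r : K r -> P r.
Proof.
move=> Kr; apply/Pf; rewrite /colon mulrC.
by case: (ideal_gen_ideal (@K2d_gens k d)) => _ _; apply.
Qed.

(** The ring is R modulo the elements that some member of [S] multiplies into K, that is, the image
    of R in the localisation of R/K. The image of [f] is nonzero because [s * f] in K would put [s]
    in [P]. *)
Lemma loc_quotient (S : R -> Prop) :
  S 1 -> (forall s t, S s -> S t -> S (s * t)) -> (forall s, S s -> ~ P s) ->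
  exists (A : comNzRingType) (pi : {rmorphism R -> A}),
    [/\ forall r, K r -> pi r = 0, forall r, pi r = 0 -> exists2 s, S s & K (s * r),
        forall s, S s -> reg (pi s), pi f <> 0 & forall r, pi r = 0 -> P r].
Proof.
move=> S1 SM SP; have [K0 KD KM] := ideal_gen_ideal (@K2d_gens k d).
pose I r := exists2 s, S s & K (s * r).
have idI : is_ideal I.
  split=> [|r r' [s hs h] [s' hs' h']|r r' [s hs h]].
  - by exists 1 => //; rewrite mulr0.
  - exists (s * s'); first exact: SM.
    rewrite (_ : _ * _ = s' * (s * r) + s * (s' * r')); last by ring.
    by apply: KD; apply: KM.
  - by exists s => //; rewrite mulrCA; apply: KM.
have IP r : I r -> P r.
  by case=> s hs /K_sub_P /primeM [] // /(SP s hs).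
have I1 : ~ I 1 by move=> /IP; case: primeP.
have [A [pi [hpi surj]]] := quotient_exists idI I1.
exists A, pi; split.
- by move=> r Kr; apply/hpi; exists 1 => //; rewrite mul1r.
- by move=> r /hpi.
- move=> s hs y; have [r ->] := surj y; rewrite -rmorphM => /hpi [s' hs' h].
  by apply/hpi; exists (s' * s); [apply: SM | rewrite -mulrA].
- by move=> /hpi [s hs h]; apply: (SP s hs); apply/Pf.
- by move=> r /hpi /IP.
Qed.

Lemma loc_quotientP :
  exists (A : comNzRingType) (pi : {rmorphism R -> A}),
    [/\ forall r, K r -> pi r = 0, forall r, pi r = 0 -> exists2 s, ~ P s & K (s * r),
        forall s, ~ P s -> reg (pi s), pi f <> 0 & forall r, pi r = 0 -> P r].
Proof.
apply: loc_quotient => //; first by case: primeP.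
by move=> s t hs ht /primeM[].
Qed.

(** The localised relations identify every polynomial with its image under [phi17], so [phi17 f] is
    nonzero; then [r * f] in K forces [phi17 r = 0]. *)
Lemma case_Q17 : ~ P (aa 4) -> ~ P (cc 2) -> ~ P (bb 2) -> same_ideal P (@Q17_2 k d).
Proof.
move=> Pa Pc Pb; have [A [pi [kK _ hreg fn0 piP]]] := loc_quotientP.
have hK := K_krel kK.
have [[/= a2 a1 b3] _ _] := krel_reg42 hK (hreg _ Pa) (hreg _ Pc).
have [/= b1 b4 c3 c1 c4] := krel_reg4223 hK (hreg _ Pa) (hreg _ Pc) (hreg _ Pb).
have pi17 r : pi (phi17 r) = pi r.
  rewrite /phi17 /=; apply: hom_sub.
  by four_cases; hom; rewrite ?a1 ?a2 ?b1 ?b3 ?b4 ?c4 ?c1 ?c3.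
have f17 : phi17 f != 0 by apply/eqP => h; apply: fn0; rewrite -pi17 h rmorph0.
move=> r; split=> [/Pf /(@K_phi17)|/Q17P h].
  rewrite rmorphM => /eqP; rewrite mulf_eq0 (negbTE f17) orbF => /eqP h.
  exact/Q17P.
by apply: piP; rewrite -pi17 h rmorph0.
Qed.

Lemma case_Q5 : ~ P (aa 4) -> ~ P (cc 2) -> P (bb 2) -> same_ideal P (@Q5 k).
Proof.
move=> Pa Pc Pb.
have f17 : phi17 f = 0.
  have /Pf /(@K_phi17) := Pb; rewrite rmorphM => /eqP.
  by rewrite mulf_eq0 /phi17; hom; rewrite (negbTE (bb_neq0 k 2)) => /eqP.
(* Denominators are kept outside Q17 as well as [P], so that an equation of the quotient can be
   carried to R by [phi17] and its denominator cancelled there. *)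
have [|||A [pi [kK locK hreg fn0 piP]]] :=
  @loc_quotient (fun s => ~ P s /\ phi17 s <> 0).
- by split; [case: primeP | rewrite rmorph1; apply/eqP/oner_neq0].
- move=> s t [Ps hs] [Pt ht]; split; first by case/primeM.
  by move: hs ht => /eqP hs /eqP ht; rewrite rmorphM; apply/eqP; rewrite mulf_neq0.
- by move=> s [].
have ra4 : reg (pi (aa 4)).
  by apply: hreg; split=> //; rewrite /phi17; hom; apply/eqP/aa_neq0.
have rc2 : reg (pi (cc 2)).
  by apply: hreg; split=> //; rewrite /phi17; hom; apply/eqP/cc_neq0.
have hK := K_krel kK.
have [[/= a2 a1 b3] [/= g c1 c4] [/= ec eb1 eb4]] := krel_reg42 hK ra4 rc2.
(* Otherwise [pi f = pi (bb 2 ^+ N * u)] for some [u]. As [phi17 f = 0], also [phi17 u = 0]; but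
   multiplication by [bb 2 ^+ N] identifies [u] with [phi17 u], so [pi f] would be zero. *)
have notJ5 : ~ J5 N f.
  move=> J5f.
  have [u eu] : exists u, pi f = pi (bb 2 ^+ N * u).
    pose I r := exists u, pi r = pi (bb 2 ^+ N * u).
    have idI : is_ideal I.
      split=> [|r s [u hu] [v hv]|r s [u hu]]; first by exists 0; rewrite mulr0.
        by exists (u + v); rewrite mulrDr !rmorphD hu hv.
      by exists (r * u); rewrite rmorphM hu -rmorphM mulrCA.
    have I0 r : pi r = 0 -> I r by move=> h; exists 0; rewrite h mulr0 rmorph0.
    have I00 r : I (r - r) by apply: I0; rewrite subrr rmorph0.
    have hI : I (f - psi5 f).
      rewrite /psi5 /=; apply: sub_congr => //.
      four_cases; split=> //=; rewrite ?subr0.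
      - by apply: I0; hom; rewrite a1 subrr.
      - by exists (cc 2); hom.
      - by apply: I0; hom; rewrite a2 subrr.
      - by apply: I0; hom; rewrite b3 subrr.
      - by exists (cc 3); hom.
    apply/(ideal_congr idI hI); have [u [v ->]] := J5_gen J5f.
    by exists u; rewrite rmorphD [pi (_ * v)]rmorphM rmorphB !rmorphM g subrr mul0r addr0.
  have [s [Ps /eqP s17] /(@K_phi17)] : exists2 s, ~ P s /\ phi17 s <> 0 &
      K (s * (f - bb 2 ^+ N * u)).
    by apply: locK; rewrite rmorphB eu subrr.
  rewrite rmorphM rmorphB f17 sub0r => /eqP; rewrite mulf_eq0 (negbTE s17) oppr_eq0 rmorphM.
  have b17 : phi17 (bb 2 ^+ N) != 0.
    by rewrite rmorphXn expf_neq0 // /phi17; hom; rewrite bb_neq0.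
  rewrite mulf_eq0 (negbTE b17).
  move=> /eqP u17; apply: fn0; rewrite eu.
  have idI : is_ideal (fun r => pi (bb 2 ^+ N * r) = 0).
    split=> [|r t hr ht|r t ht]; first by rewrite mulr0 rmorph0.
      by rewrite mulrDr rmorphD hr ht addr0.
    by rewrite mulrCA rmorphM ht mulr0.
  have hI : pi (bb 2 ^+ N * (u - phi17 u)) = 0.
    rewrite /phi17 /=; apply: (sub_congr idI).
    have I00 r : pi (bb 2 ^+ N * (r - r)) = 0 by rewrite subrr mulr0 rmorph0.
    four_cases; split=> //=; hom; rewrite ?a1 ?a2 ?b3 ?c1 ?c4 ?subrr ?mulr0 //.
      by rewrite -opprB mulrN ec oppr0.
    by rewrite -mulrBr -opprB mulrN ec oppr0 mulr0.
  by apply/(ideal_congr idI hI); rewrite u17 mulr0 rmorph0.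
move=> r; split.
  move=> /Pf /K_J5 h; apply/(Q5P).
  by case: (pideal_primary (zb2P) h).
have PN y : P (bb 2 ^+ N * y) by apply: primeMr; apply: primeXr (Ngt0) _.
have tr y z : pi y = pi z -> P z -> P y.
  by move=> e Pz; apply/(ideal_congr idP (_ : P (y - z))) => //; apply: piP; rewrite rmorphB e subrr.
rewrite /Q5 -(vaE k) -(vbE k) -(vcE k); apply: (ideal_gen_foldr idP) => /=.
do !split.
- by apply: tr (PN (cc 2)); hom.
- by apply: tr (PN (cc 3)); hom.
- apply: (tr _ (bb 2 ^+ d * aa 4)); first by hom.
  by apply/primeMr/primeXr.
- apply: (tr _ (bb 2 * aa 3)); first by hom.
  exact: primeMr.
- by [].
- exact: (tr _ (bb 2)).
- by apply: piP; rewrite rmorphB !rmorphM g subrr.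
Qed.

Lemma case_Q3 : ~ P (aa 4) -> P (cc 2) -> ~ P (cc 3) -> same_ideal P (@Q3 k).
Proof.
move=> Pa Pc2 Pc3; have [A [pi [kK _ hreg fn0 piP]]] := loc_quotientP.
have hK := K_krel kK.
have rcc : reg (pi (cc 2) - pi (cc 3)).
  rewrite -rmorphB; apply: hreg => h; apply: Pc3.
  exact/(ideal_congr idP h).
have [[/= a2 a1 b3] [/= c1 c4 g]] := krel_reg43 hK (hreg _ Pa) (hreg _ Pc3) rcc.
have J5f : J5 N f.
  have /Pf /K_J5 := Pc2; apply: (pideal_cancel (zb2P)).
  by rewrite /phi5 /zb2; hom; hom; rewrite cc_neq0.
have notJ3 : ~ J3 N f.
  move=> J3f; apply: fn0.
  (* The factor [cc 3] puts the product into Q2. In the quotient [cc 1] is zero, so the multiple of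
     [x * cc 1] disappears, and both [x] and [cc 3] are regular. *)
  have [|||u /kK] := @Ke_of_primary (cc 3 * f).
  - by rewrite rmorphM /phi2; hom; rewrite mul0r.
  - by case: (pideal_ideal (phi3) (bb 3) N) => _ _; apply.
  - by case: (pideal_ideal (phi5) (bb 2) N) => _ _; apply.
  rewrite rmorphB !rmorphM c1 mulr0 mul0r subr0 rmorphXn.
  have rx : reg (pi (aa 4) ^+ d) by apply: regX; apply: hreg.
  by move=> h; apply/(hreg _ Pc3)/rx.
have tr y z : pi y = pi z -> P z -> P y.
  by move=> e Pz; apply/(ideal_congr idP (_ : P (y - z))) => //; apply: piP; rewrite rmorphB e subrr.
have Pb3 : P (bb 3) by apply: (@primeX _ N); apply: piP; rewrite rmorphXn.
move=> r; split.
  move=> /Pf /K_J3 h; apply/(Q3P).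
  by case: (pideal_primary (zb3P) h).
rewrite /Q3 -(vaE k) -(vbE k) -(vcE k); apply: (ideal_gen_foldr idP) => /=.
do !split.
- exact: piP.
- exact: Pc2.
- exact: piP.
- apply: (tr _ (bb 3 ^+ d * aa 4)); first by hom.
  by apply/primeMr/primeXr.
- apply: (tr _ (bb 3 * aa 3)); first by hom.
  exact: primeMr.
- exact: Pb3.
- have /primeM [] // : P (cc 3 * bb 4).
  apply: (tr _ (cc 2 * bb 1)); first by hom.
  exact: primeMr.
Qed.
End PrimeCase.

(** * Associated primes containing b04 but not all the c1 i *)

Section CaseQ1.
Variables (P : R -> Prop) (f : R).
Hypotheses (primeP : is_prime_ideal P) (Pf : same_ideal P (colon K f)).
Let idP := prime_ideal primeP.

Section Saturation.
Variable i : nat.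
Hypothesis hi : (0 < i <= 4)%N.
Local Notation b := (bb i).

(* Up to the substitution sat_red for b0 1, this is K localised at c1 i, with its last
   five generators divided by b0 4 ^+ d. *)
Definition sat_gens : seq R :=
  (aa 2 - b * aa 3) :: [seq cc j * (bb j - b) | j <- iota 1 4] ++
  [:: cc 1 - b ^+ N * cc 2; cc 4 - b ^+ N * cc 3; b ^+ N * (cc 2 - cc 3);
      cc 2 * bb 1 - cc 3 * bb 4; cc 2 * (bb 2 - bb 3)].

Definition sat_red : {rmorphism R -> R} :=
  sub (four (b ^+ d * aa 4) (aa 2) (aa 3) (aa 4)) bb cc.

Definition sat r := ideal_gen sat_gens (sat_red r).

Lemma sat_gens_fixed : {in sat_gens, forall g, za4 g = g}.
Proof.
move=> g; rewrite inE mem_cat => /or3P[/eqP ->|/mapP[j]|].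
- by rewrite /za4; hom; rewrite subst_bb.
- by rewrite mem_iota => hj ->; rewrite /za4; hom; rewrite !subst_bb // subst_cc.
by rewrite !inE => /or4P[||/eqP ->|/orP[]] => [/eqP ->|/eqP ->||/eqP ->|/eqP ->];
  rewrite /za4; hom; rewrite ?subst_bb.
Qed.

Lemma sat_reg n r : sat (aa 4 ^+ n * r) -> sat r.
Proof.
elim: n r => [|n IH] r; first by rewrite mul1r.
rewrite exprS -mulrA /sat rmorphM {1}/sat_red /= ?subst_vars /= => h.
by apply: IH; apply: reg_gen (za4P) sat_gens_fixed h.
Qed.

Lemma K_sat r : K r -> sat r.
Proof.
move=> Kr; apply: ideal_hom (ideal_gen_ideal _) _ => A pi kS.
have kn g : g \in sat_gens -> pi g = 0 by move=> /mem_ideal_gen /kS.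
have eS g h : (g - h) \in sat_gens -> pi g = pi h.
  by move=> /kn; rewrite rmorphB => /subr0_eq.
have e2 : pi (aa 2) = pi b * pi (aa 3) by rewrite -rmorphM; apply: eS; rewrite mem_head.
have eb j : (0 < j <= 4)%N -> pi (cc j) * pi (bb j) = pi (cc j) * pi b.
  move=> hj; apply/subr0_eq; rewrite -mulrBr -rmorphB -rmorphM; apply: kn.
  rewrite inE mem_cat; apply/or3P; apply: Or32; apply/mapP; exists j => //.
  by rewrite mem_iota.
have ht n : (n < 5)%N -> pi (nth 0 [:: cc 1 - b ^+ N * cc 2; cc 4 - b ^+ N * cc 3;
    b ^+ N * (cc 2 - cc 3); cc 2 * bb 1 - cc 3 * bb 4; cc 2 * (bb 2 - bb 3)] n) = 0.
  by move=> hn; apply: kn; rewrite inE mem_cat mem_nth ?orbT.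
have := (ht 0 isT, ht 1 isT, ht 2 isT, (ht 3 isT, ht 4 isT)); hom.
case=> -[[/subr0_eq c1 /subr0_eq c4] /eqP]; rewrite mulrBr subr_eq0 => /eqP c23.
case=> /subr0_eq g /eqP; rewrite mulrBr subr_eq0 => /eqP b23.
apply: (@K_min_hom A (pi \o sat_red)) Kr; rewrite /sat_red.
split=> [|||||]; first split; rewrite /=.
- by hom; hom; rewrite e2 exprMn; ring.
- by move=> j hj; rewrite subst_bb // subst_cc //; hom; hom; rewrite e2 !mulrA eb.
- move=> j hj; rewrite subst_bb // subst_cc //; hom; hom.
  by rewrite !mulrA (mulr_congrX _ (eb j hj)).
- move=> j l hj hl; rewrite !subst_bb // !subst_cc //.
  transitivity (pi (cc l) * (pi (cc j) * pi (bb j)) - pi (cc j) * (pi (cc l) * pi (bb l))).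
    by ring.
  by rewrite !eb //; ring.
- by hom; hom; rewrite c1 exprMn exprN; ring.
- by hom; hom; rewrite c4 exprMn exprN; ring.
- by hom; hom; rewrite !exprMn -!exprN mulrAC c23 mulrAC.
- by hom; hom; rewrite g.
- by hom; hom; rewrite b23.
Qed.

(** The factor [x] puts back what was divided out of the last five generators. *)
Lemma sat_kill (A : comNzRingType) (pi : {rmorphism R -> A}) r :
  (forall r, K r -> pi r = 0) -> reg (pi (cc i)) -> sat r -> pi (x * r) = 0.
Proof.
move=> kK rc sr; have hK := K_krel kK.
have /= a1 := krel_reg_a1 hK hi rc; have /= a2 := krel_reg_a2 hK hi rc.
have /= a1X := krel_reg_a1X hK hi rc.
have -> : pi (x * r) = pi (x * sat_red r).
  rewrite rmorphM -[pi r](_ : pi (sat_red r) = _) -?rmorphM //.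
  by rewrite /sat_red /=; apply: hom_sub; four_cases; hom; rewrite a1.
have idI : is_ideal (fun r => pi (x * r) = 0).
  split=> [|u t hu ht|u t ht]; first by rewrite mulr0 rmorph0.
    by rewrite mulrDr rmorphD hu ht addr0.
  by rewrite mulrCA rmorphM ht mulr0.
apply: (ideal_gen_min idI _ sr) => g; rewrite inE mem_cat => /or3P[/eqP ->|/mapP[j]|].
- by hom; rewrite a2 subrr mulr0.
- rewrite mem_iota => hj ->; hom; rewrite (_ : _ * (_ - _) = 0) ?mulr0 //.
  exact: (krel_reg_bb hK hi hj rc).
have [[/= h1 h2] h3] := (krel_h1 hK, krel_h2 hK, krel_h3 hK).
have [/= h4 h5] := (krel_h4 hK, krel_h5 hK).
rewrite !inE => /or4P[||/eqP ->|/orP[]] => [/eqP ->|/eqP ->||/eqP ->|/eqP ->]; hom; rewrite mulrBr.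
- by rewrite h1 a1X; ring.
- by rewrite h2 a1X; ring.
- move: h3 => /=; rewrite a1X => h3; apply/eqP; rewrite mulrBr subr_eq0; apply/eqP.
  by rewrite !mulrA ![_ * pi b ^+ _]mulrC h3.
- by rewrite h4 subrr.
- by rewrite mulrBr h5 subrr.
Qed.
End Saturation.

Variable i0 : nat.
Hypotheses (hi0 : (0 < i0 <= 4)%N) (Pa4 : P (aa 4)) (Pc : ~ P (cc i0)).
Local Notation b := (bb i0).
Definition outP i := ~~ boolp_pred P (cc i).

Lemma outPP i : reflect (~ P (cc i)) (outP i).
Proof. by apply: (iffP negP) => h /(boolp_predP P). Qed.

Local Notation cP i := (if outP i then cc i else 0).

Definition phi1 : {rmorphism R -> R} :=
  sub (four (b ^+ d * aa 4) (b * aa 3) (aa 3) (aa 4))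
      (fun i => if outP i then b else bb i) (fun i => if outP i then cc i else 0).

Lemma K_phi1 r : K r -> pideal phi1 (aa 4) d r.
Proof.
have mb : outP i0 by apply/outPP.
apply: (K_min (pideal_ideal phi1 (aa 4) d)) => [|i hi|i j /andP[i0' ij] j4|].
- by apply: pideal_ker; rewrite /phi1; hom; rewrite ?subst_bb // exprMn; ring.
- split; apply: pideal_ker; rewrite /phi1; hom; rewrite ?subst_bb // ?subst_cc //;
  by case: (outP i); rewrite ?mul0r // subrr mulr0.
- have hi : (0 < i <= 4)%N by rewrite i0' (leq_trans (ltnW ij)).
  have hj : (0 < j <= 4)%N by rewrite j4 (leq_trans i0' (ltnW ij)).
  apply: pideal_ker; rewrite /phi1; hom; rewrite ?subst_bb // ?subst_cc //.
  by case: (outP i); case: (outP j); rewrite ?mul0r ?mulr0 ?mul0r // subrr mulr0.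
rewrite /=; do !split; rewrite /pideal /phi1 /divides; hom; rewrite ?exprMn -?exprN.
- by exists (cP 1 - b ^+ N * cP 2); ring.
- by exists (cP 4 - b ^+ N * cP 3); ring.
- by exists (b ^+ N * (cP 2 - cP 3)); ring.
- by eexists; reflexivity.
- by eexists; rewrite -mulrA; reflexivity.
Qed.

(** Setting to zero the [cc i] lying in [P] does not change [f] modulo [Kx], and the assumed
    divisibility makes the result a multiple of [x]; so [pi f = pi (x * t)]. On the other hand
    [aa 4 * f] in K puts [f] in [sat i0], and since [aa 4] is regular modulo it, [r * t] is there
    too for some [r] outside [P]. By [sat_kill] the image of [x * t], hence of [f], is zero. *)
Lemma not_phi1 : ~ pideal phi1 (aa 4) d f.
Proof.
case=> q eq; have [A [pi [kK locK hreg fn0 piP]]] := loc_quotientP primeP Pf.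
have hK := K_krel kK; apply: fn0.
have rc := hreg _ Pc.
have /= a1 := krel_reg_a1 hK hi0 rc; have /= a2 := krel_reg_a2 hK hi0 rc.
have ebb i : (0 < i <= 4)%N -> outP i -> pi (bb i) = pi b.
  move=> hi /outPP mi; apply/subr0_eq/(hreg _ mi).
  exact: (krel_reg_bb hK hi0 hi rc).
pose s := [seq i <- iota 1 4 | ~~ outP i].
have Ts : Kx (f - zs s f).
  apply: Kx_zs => i; rewrite mem_filter mem_iota => /andP[/negbNE /boolp_predP Pi hi] //.
  by apply: K_Kx; apply/Pf.
have [t et] : exists t, pi f = pi (x * t).
  pose I r := exists t, pi r = pi (x * t).
  have idI : is_ideal I.
    split=> [|r r' [u hu] [v hv]|r r' [u hu]]; first by exists 0; rewrite mulr0.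
      by exists (u + v); rewrite mulrDr !rmorphD hu hv.
    by exists (r * u); rewrite rmorphM hu -rmorphM mulrCA.
  have hI : I (f - zs s f).
    apply: (ideal_gen_min idI _ Ts) => g; rewrite inE => /orP[/eqP ->|hg].
      by exists 1; rewrite mulr1.
    exists 0; rewrite mulr0 rmorph0; apply/kK/mem_ideal_gen.
    by rewrite K2d_gens_cat mem_cat hg.
  apply/(ideal_congr idI hI).
  pose phi' : {rmorphism R -> R} := sub (four (b ^+ d * aa 4) (b * aa 3) (aa 3) (aa 4))
      (fun i => if outP i then b else bb i) cc.
  exists q; rewrite -eq -[LHS](_ : pi (phi' (zs s f)) = _).
    congr (pi _); rewrite /phi' /zs /phi1 /=; apply: sub_sub => i hi.
    rewrite subst_aa // subst_bb //; split=> //.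
    rewrite mem_filter mem_iota (hi : (1 <= i < 1 + 4)%N) andbT.
    by case: (outP i); rewrite /= ?rmorph0 // subst_cc.
  rewrite /phi' /=; apply: hom_sub => i hi; split=> //.
    by case: i hi => [|[|[|[|[|i]]]]] // _; hom; rewrite ?a1 ?a2.
  by case: ifP => // mi; rewrite (ebb i).
rewrite et.
have [r Pr Kr] : exists2 s, ~ P s & K (s * (f - x * t)) by apply: locK; rewrite rmorphB et subrr.
have satI : is_ideal (sat i0).
  have [h0 hD hM] := ideal_gen_ideal (sat_gens i0).
  split=> [|u v|u v]; rewrite /sat ?rmorph0 ?rmorphD ?rmorphM; [exact: h0 | exact: hD | exact: hM].
have satf : sat i0 f.
  by apply: (@sat_reg _ hi0 1); rewrite expr1; apply: K_sat => //; apply/Pf.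
have : sat i0 (r * t).
  apply: (@sat_reg _ hi0 d).
  rewrite mulrCA; have := K_sat i0 Kr; rewrite mulrBr => h.
  apply/(ideal_congr satI h).
  by case: satI => _ _; apply.
move=> /(sat_kill hi0 kK rc); rewrite mulrCA rmorphM.
exact: (hreg _ Pr).
Qed.

Definition setP : {set 'I_4} := [set i : 'I_4 | outP i.+1].

Lemma Q1_sub_P r : @Q1 k setP r -> P r.
Proof.
have [A [pi [kK locK hreg fn0 piP]]] := loc_quotientP primeP Pf.
have hK := K_krel kK; have rc := hreg _ Pc.
have /= a1 := krel_reg_a1 hK hi0 rc; have /= a2 := krel_reg_a2 hK hi0 rc.
have ebb i : (0 < i <= 4)%N -> outP i -> pi (bb i) = pi b.
  move=> hi /outPP mi; apply/subr0_eq/(hreg _ mi).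
  exact: (krel_reg_bb hK hi0 hi rc).
have h4 (i : 'I_4) : (0 < i.+1 <= 4)%N by case: i.
rewrite /Q1 -(vaE k) -(vbE k) -(vcE k); apply: (ideal_gen_min idP) => g.
rewrite !mem_cat !inE => /or4P[/orP[]/eqP ->||/mapP[i]|/mapP[[i j]]] //.
- have h : P (aa 1 - b ^+ d * aa 4) by apply: piP; hom; rewrite a1 subrr.
  by apply/(ideal_congr idP h); apply: (primeMl primeP).
- by move=> /mapP[i]; rewrite mem_enum !inE => /negbNE /boolp_predP Pi ->.
- by rewrite mem_enum inE => mi ->; apply: piP; hom; rewrite a2 (ebb i.+1) // subrr.
move=> /allpairsP[[u v] []]; rewrite !mem_enum !inE /= => mu mv [-> ->] ->.
by apply: piP; rewrite rmorphB (ebb u.+1) // (ebb v.+1) // subrr.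
Qed.

Lemma phi1_sub_Q1 r : za4 (phi1 r) = 0 -> @Q1 k setP r.
Proof.
have mb : outP i0 by apply/outPP.
have hset i : (0 < i <= 4)%N -> exists j : 'I_4, i = j.+1.
  by case: i => // i hi; exists (Ordinal hi).
move=> r0; rewrite /Q1 -(vaE k) -(vbE k) -(vcE k).
apply: ideal_hom (ideal_gen_ideal _) _ => A pi kS.
have kn g := kS g (mem_ideal_gen _).
have a1 : pi (aa 1) = 0 by apply/kS/mem_ideal_gen; rewrite mem_head.
have a4 : pi (aa 4) = 0 by apply/kS/mem_ideal_gen; rewrite !inE eqxx orbT.
have hc i : (0 < i <= 4)%N -> ~~ outP i -> pi (cc i) = 0.
  move=> hi mi; have [j ej] := hset i hi; apply/kS/mem_ideal_gen.
  rewrite mem_cat; apply/orP; right; rewrite mem_cat; apply/orP; left.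
  by apply/mapP; exists j; rewrite ?mem_enum ?inE -?ej.
have ha2 i : (0 < i <= 4)%N -> outP i -> pi (aa 2) = pi (bb i) * pi (aa 3).
  move=> hi mi; have [j ej] := hset i hi; apply/subr0_eq; rewrite -rmorphM -rmorphB.
  apply/kS/mem_ideal_gen; rewrite mem_cat; apply/orP; right; rewrite mem_cat; apply/orP; right.
  rewrite mem_cat; apply/orP; left.
  by apply/mapP; exists j; rewrite ?mem_enum ?inE -?ej.
have hb i : (0 < i <= 4)%N -> outP i -> pi b = pi (bb i).
  move=> hi mi; have [j ej] := hset i hi; have [j0 ej0] := hset i0 hi0.
  apply/subr0_eq; rewrite -rmorphB.
  apply/kS/mem_ideal_gen; rewrite mem_cat; apply/orP; right; rewrite mem_cat; apply/orP; right.
  rewrite mem_cat; apply/orP; right.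
  apply/mapP; exists (j0, j); last by rewrite /= -ej -ej0.
  by apply/allpairsP; exists (j0, j); rewrite !mem_enum !inE -ej -ej0.
pose w : {rmorphism R -> R} := sub (four 0 (b * aa 3) (aa 3) 0)
  (fun i => if outP i then b else bb i) (fun i => if outP i then cc i else 0).
rewrite -[pi r](_ : pi (w r) = _).
  rewrite (_ : w r = 0) ?rmorph0 // -r0 /w /za4 /phi1 /=; symmetry; apply: sub_sub => i hi.
  split.
  - by case: i hi => [|[|[|[|[|i]]]]] // _; hom; rewrite ?mulr0 ?subst_bb.
  - by case: (outP i); rewrite subst_bb.
  - by case: (outP i); rewrite ?rmorph0 ?subst_cc.
rewrite /w /=; apply: hom_sub => i hi; split.
- by case: i hi => [|[|[|[|[|i]]]]] // _; hom; rewrite ?a1 ?a4 // (ha2 i0).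
- by case: ifP => // mi; apply: hb.
- by case: ifP => // /negbT mi; rewrite rmorph0 hc.
Qed.

Lemma case_Q1 : exists L : {set 'I_4}, L != set0 /\ same_ideal P (@Q1 k L).
Proof.
exists setP; split.
  have [i e] : exists i : 'I_4, i0 = i.+1 by case: i0 hi0 => // i hi; exists (Ordinal hi).
  by apply/set0Pn; exists i; rewrite inE -e; apply/outPP.
move=> r; split; last exact: Q1_sub_P.
move=> /Pf /K_phi1 h; apply: phi1_sub_Q1.
by case: (pideal_primary (za4P) h) => // /not_phi1.
Qed.
End CaseQ1.

Local Notation e := (x * cc 1).

(** * Associated primes containing all the c1 i *)

Section ColonQ20.
Definition b20 := four (bb 1) (bb 2) (bb 2) (bb 1).
Definition w20 := four (bb 2 ^+ N) 1 1 (bb 2 ^+ N).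

Definition Phi i : {rmorphism R -> R} :=
  sub (four (b20 i ^+ d * aa 4) 0 0 (aa 4)) b20 (fun j => if j == i then w20 i * cc 1 else 0).

(* Phi i keeps c1 i as the only variable of its kind, with the weight under which the
   images of the last five generators cancel in the sum.  The Phi i agree after setting
   the variables b0 j and c1 j to zero, which makes I20 an ideal. *)
Definition I20 r := exists q : nat -> R,
  (forall i, (0 < i <= 4)%N -> Phi i r = e * q i) /\ phi20 (q 1 + q 2 + q 3 + q 4) = 0.

Lemma phi20_Phi i r : (0 < i <= 4)%N -> phi20 (Phi i r) = phi20 r.
Proof.
move=> hi; rewrite /phi20 /Phi /=; apply: sub_sub => j hj; split.
- by case: j hj => [|[|[|[|[|j]]]]] // _; hom; rewrite ?mulr0.
- by case: j hj => [|[|[|[|[|j]]]]] // _; rewrite /b20; hom.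
- by case: ifP => _; hom; rewrite ?mulr0.
Qed.

Lemma I20_ideal : is_ideal I20.
Proof.
split=> [|r s [p [hp p0]] [q [hq q0]]|r s [q [hq q0]]].
- exists (fun=> 0); split=> [i _|]; last by rewrite !addr0 rmorph0.
  by rewrite rmorph0 mulr0.
- exists (fun i => p i + q i); split=> [i hi|].
    by rewrite rmorphD hp // hq // mulrDr.
  rewrite (_ : _ + _ = (p 1 + p 2 + p 3 + p 4) + (q 1 + q 2 + q 3 + q 4)); last by ring.
  by rewrite rmorphD p0 q0 addr0.
- have [p hp] : exists p : nat -> R, forall i, Phi i r = p i by exists (fun i => Phi i r).
  have h20 i : (0 < i <= 4)%N -> phi20 (p i) = phi20 r by rewrite -hp; apply: phi20_Phi.
  exists (fun i => p i * q i); split=> [i hi|]; first by rewrite rmorphM hq // hp mulrCA.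
  have : phi20 r * phi20 (q 1 + q 2 + q 3 + q 4) = 0 by rewrite q0 mulr0.
  rewrite 6!(rmorphD (phi20)) 4!(rmorphM (phi20)) => <-.
  rewrite (h20 1%N isT) (h20 2%N isT) (h20 3%N isT) (h20 4%N isT).
  by rewrite !mulrDr.
Qed.

Lemma I20_0 r : (forall i, (0 < i <= 4)%N -> Phi i r = 0) -> I20 r.
Proof.
move=> h; exists (fun=> 0); split=> [i hi|]; last by rewrite !addr0 rmorph0.
by rewrite (h i hi) mulr0.
Qed.

Lemma K_I20 r : K r -> I20 r.
Proof.
apply: (K_min I20_ideal) => [|j hj|j l /andP[j0 jl] l4|].
- by apply: I20_0 => i hi; rewrite /Phi; hom; rewrite (exprd0) !mulr0 subrr.
- split; apply: I20_0 => i hi; rewrite /Phi; hom; rewrite subst_bb // subst_cc //;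
  by case: eqP => [->|]; rewrite ?mul0r // ?mulr0 ?subr0 ?mulr0 ?subrr ?mulr0.
- have hj : (0 < j <= 4)%N by rewrite j0 (leq_trans (ltnW jl)).
  have hl : (0 < l <= 4)%N by rewrite l4 (leq_trans j0 (ltnW jl)).
  apply: I20_0 => i hi; rewrite /Phi; hom; rewrite !subst_bb // !subst_cc //.
  have [ji|ji] := eqVneq j i; last by rewrite !mul0r.
  by rewrite -ji [l == j](gtn_eqF jl) mulr0 mul0r.
(* The first four of these generators have opposite cofactors at two indices; the fifth is killed by
   every [Phi i]. *)
rewrite /=; do !split.
- exists (four (bb 2 ^+ N) (- bb 2 ^+ N) 0 0); split.
    by four_cases; rewrite /Phi; hom; rewrite ?exprMn -?exprN; ring.
  by rewrite -[RHS](rmorph0 (phi20)); congr (phi20 _) => /=; ring.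
- exists (four 0 0 (- bb 2 ^+ N) (bb 2 ^+ N)); split.
    by four_cases; rewrite /Phi; hom; rewrite ?exprMn -?exprN; ring.
  by rewrite -[RHS](rmorph0 (phi20)); congr (phi20 _) => /=; ring.
- exists (four 0 (bb 2 ^+ N) (- bb 2 ^+ N) 0); split.
    by four_cases; rewrite /Phi; hom; rewrite ?exprMn -?exprN; ring.
  by rewrite -[RHS](rmorph0 (phi20)); congr (phi20 _) => /=; ring.
- exists (four 0 (bb 1) (- bb 1) 0); split.
    by four_cases; rewrite /Phi; hom; ring.
  by rewrite -[RHS](rmorph0 (phi20)); congr (phi20 _) => /=; ring.
- by apply: I20_0; four_cases; rewrite /Phi; hom; ring.
Qed.

Lemma e_neq0 : e != 0 :> R.
Proof. by rewrite mulf_neq0 ?expf_neq0 ?aa_neq0 ?cc_neq0. Qed.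

(** For [i] other than 1, [Phi i] kills [e], so the sum of the cofactors of [r * e] is the single
    term [bb 2 ^+ N * Phi 1 r]. *)
Lemma colon_Q20 r : K (r * e) -> phi20 r = 0.
Proof.
move=> /K_I20 [q [hq q0]].
have q1 : q 1 = bb 2 ^+ N * Phi 1 r.
  apply: (mulfI e_neq0); rewrite -hq // rmorphM.
  by rewrite [Phi 1 e](_ : _ = e * bb 2 ^+ N); [ring | rewrite /Phi; hom; ring].
have qi i : (1 < i <= 4)%N -> q i = 0.
  case/andP=> i1 i4; have hi : (0 < i <= 4)%N by rewrite i4 ltnW.
  apply: (mulfI e_neq0); rewrite -hq // rmorphM [Phi i e](_ : _ = 0) ?mulr0 //.
  by rewrite /Phi; hom; rewrite (ltn_eqF i1) mulr0.
move: q0; rewrite q1 !qi // !addr0 rmorphM phi20_Phi // => /eqP; rewrite mulf_eq0.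
rewrite [_ (bb 2 ^+ N) == 0](_ : _ = false) => [/eqP //|].
by apply/negbTE; rewrite rmorphXn expf_neq0 // /phi20; hom; rewrite bb_neq0.
Qed.
End ColonQ20.

(** An argument by order in [cc 1]: [Psi] kills every generator of K except possibly those quadratic
    in the [cc i], so it maps K to multiples of [cc 1 ^+ 2], while [Psi e] has order one. Hence
    [cc 1] divides [Psi r], whose value at [cc 1 = 0] is [phi19 alpha r]. *)
Lemma colon_Q19 alpha r : alpha ^+ d = 1 -> K (r * e) -> phi19 alpha r = 0.
Proof.
move=> ha; have haP : (alpha%:MP_[14]) ^+ d = 1 :> R by rewrite -rmorphXn ha rmorph1.
pose Psi : {rmorphism R -> R} := sub (four (bb 1 ^+ d * aa 4) 0 0 (aa 4))
  (four (bb 1) (alpha%:MP * bb 1) (alpha%:MP * bb 1) (bb 1))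
  (four (bb 1 ^+ N * cc 1) (cc 1) (cc 1) (bb 1 ^+ N * cc 1)).
have zPsi s : zc 1 (Psi s) = phi19 alpha s.
  rewrite /zc /Psi /phi19 /=; apply: sub_sub; four_cases; hom; rewrite ?substC ?mulr0 //;
  by rewrite mul_mpolyC.
have KPsi s : K s -> pideal Psi (cc 1) 2 s.
  apply: (K_min (pideal_ideal Psi (cc 1) 2)) => [|j hj|j l /andP[j0 jl] l4|].
  - by apply: pideal_ker; rewrite /Psi; hom; rewrite (exprd0); ring.
  - split; apply: pideal_ker; rewrite /Psi;
    by case: j hj => [|[|[|[|[|j]]]]] // _; hom; rewrite ?exprMn ?haP; ring.
  - have hj : (0 < j <= 4)%N by rewrite j0 (leq_trans (ltnW jl)).
    have hl : (0 < l <= 4)%N by rewrite l4 (leq_trans j0 (ltnW jl)).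
    have c1 m : (0 < m <= 4)%N -> exists q, Psi (cc m) = cc 1 * q.
      case: m => [|[|[|[|[|m]]]]] // _; rewrite /Psi; hom.
      - by exists (bb 1 ^+ N); rewrite mulrC.
      - by exists 1; rewrite mulr1.
      - by exists 1; rewrite mulr1.
      - by exists (bb 1 ^+ N); rewrite mulrC.
    have [q eq] := c1 j hj; have [q' eq'] := c1 l hl.
    by exists (q * q' * Psi (bb j - bb l)); rewrite !rmorphM eq eq'; ring.
  rewrite /=; do !split; apply: pideal_ker; rewrite /Psi; hom; rewrite ?exprMn -?exprN; ring.
move=> /KPsi [q eq]; rewrite -zPsi; have [c0 zc1 _] := @zcP 1 isT.
have {eq} : Psi r * (aa 4 ^+ d * bb 1 ^+ N) = cc 1 * q.
  apply: (mulfI c0); rewrite [RHS]mulrA -expr2 -eq rmorphM.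
  by rewrite [Psi e](_ : _ = aa 4 ^+ d * bb 1 ^+ N * cc 1); [ring | rewrite /Psi; hom; ring].
move=> /(congr1 (zc 1)); rewrite [in RHS]rmorphM zc1 mul0r rmorphM => /eqP.
rewrite mulf_eq0 => /orP[/eqP //|]; rewrite rmorphM !rmorphXn /zc; hom.
by rewrite mulf_eq0 !expf_eq0 (negbTE (aa_neq0 k 4)) (negbTE (bb_neq0 k 1)) !andbF.
Qed.

(** * Roots of unity and the factorisation of b12^d - b11^d *)

Hypothesis hchar : (d%:R : k) != 0.

Lemma unity_roots : exists s : seq k,
  [/\ uniq s, forall z, (z \in s) = (z ^+ d == 1) & size s = d /\ 'X^d - 1 = \prod_(z <- s) ('X - z%:P)].
Proof.
have [s es] := closed_field_poly_normal ('X^d - 1 : {poly k}).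
rewrite lead_coefDl ?size_polyXn ?size_polyN ?size_poly1 // lead_coefXn scale1r in es.
exists s; split; last split=> //.
- by rewrite -separable_prod_XsubC -es separable_Xn_sub_1.
- move=> z; rewrite -root_prod_XsubC -es /root !hornerE subr_eq0; by rewrite ?hornerXn.
- apply/eqP; rewrite -eqSS -(size_prod_XsubC s id) -es size_XnsubC //.
Qed.

(** Evaluate the factorisation of ['X^d - 1] at [bb 2 / bb 1] in the fraction field and clear the
    denominators. *)
Lemma prod_homogeneous (s : seq k) : 'X^d - 1 = \prod_(z <- s) ('X - z%:P) -> size s = d ->
  bb 2 ^+ d - bb 1 ^+ d = \prod_(z <- s) (bb 2 - z *: bb 1).
Proof.
move=> es sz; pose iota : {rmorphism k -> {fraction R}} := @FracField.tofrac R \o @mpolyC 14 k.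
apply/eqP; rewrite -tofrac_eq; apply/eqP.
set y := FracField.tofrac (bb 2); set z := FracField.tofrac (bb 1).
have z0 : z != 0 by rewrite tofrac_eq0 bb_neq0.
have : (map_poly iota ('X^d - 1)).[y / z] = (map_poly iota (\prod_(z <- s) ('X - z%:P))).[y / z].
  by rewrite es.
rewrite rmorphB rmorph1 /= map_polyXn rmorph_prod /= horner_prod !hornerE => h.
transitivity (z ^+ d * ((y / z) ^+ d - 1)).
  by rewrite rmorphB !rmorphXn mulrBr -exprMn mulrCA divff // !mulr1.
have -> : z ^+ d = \prod_(c <- s) z by rewrite big_const_seq count_predT iter_mulr_1 sz.
rewrite h rmorph_prod /= -big_split /=; apply: eq_bigr => c _.
rewrite rmorphB /= map_polyX map_polyC !hornerE mulrBr mulrCA divff // mulr1 -mul_mpolyC.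
by rewrite rmorphB rmorphM /= mulrC.
Qed.

Definition zr (alpha : k) : {rmorphism R -> R} :=
  sub aa (four (bb 1) (alpha *: bb 1) (bb 3) (bb 4)) cc.

Lemma sub_root_neq0 (alpha beta : k) : alpha != beta -> alpha *: bb 1 - beta *: bb 1 != 0.
Proof. by move=> ab; rewrite -scalerBl scaler_eq0 subr_eq0 negb_or ab bb_neq0. Qed.

Lemma zr_root alpha beta : zr alpha (bb 2 - beta *: bb 1) = alpha *: bb 1 - beta *: bb 1.
Proof. by rewrite -!mul_mpolyC /zr; hom; rewrite substC mul_mpolyC. Qed.

Lemma zrP alpha : divisor (bb 2 - alpha *: bb 1) (zr alpha).
Proof.
apply: divisor_sub; last first.
- four_cases; split; try by exists 0; rewrite subrr mulr0.
  by exists 1; rewrite mulr1.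
- by rewrite -[LHS]/(zr alpha _) zr_root subrr.
(* Any scalar different from [alpha] would detect that the form is nonzero. *)
apply/eqP => /(congr1 (zr (alpha + 1))); rewrite zr_root rmorph0; apply/eqP/sub_root_neq0.
by rewrite -subr_eq0 addrC addKr oner_eq0.
Qed.

(** Each linear form is prime and no other one of them vanishes under its retraction, so after one
    factor is divided out the remaining retractions still kill the quotient. *)
Lemma divides_roots (s : seq k) h : uniq s -> {in s, forall z, zr z h = 0} ->
  divides (\prod_(z <- s) (bb 2 - z *: bb 1)) h.
Proof.
elim: s h => [|z s IH] h /=; first by exists h; rewrite big_nil mul1r.
case/andP=> zs us hz; have [h1 eh] := divisor_ker (zrP z) (hz z (mem_head _ _)).
have [|v ev] := IH h1 us; last by exists v; rewrite big_cons eh ev mulrA.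
move=> c cs; have := hz c; rewrite inE cs orbT eh rmorphM zr_root => /(_ isT) /eqP.
rewrite mulf_eq0 => /orP[h0|/eqP //].
have cz : c != z by apply: contraNneq zs => <-.
by have := sub_root_neq0 cz; rewrite h0.
Qed.

(** * The primes Q2, Q20 and Q19 *)

Section CaseC.
Variables (P : R -> Prop) (f : R).
Hypotheses (primeP : is_prime_ideal P) (Pf : same_ideal P (colon K f)).
Hypothesis Pc : forall i, (0 < i <= 4)%N -> P (cc i).
Let idP := prime_ideal primeP.
Let PM := primeM primeP.

Lemma case_Q2 : phi2 f != 0 -> same_ideal P (@Q2 k d).
Proof.
move=> f2 r; split.
  move=> /Pf /(@K_phi2); rewrite rmorphM => /eqP; rewrite mulf_eq0 (negbTE f2) orbF.
  by move=> /eqP /(Q2P).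
rewrite /Q2 /C1_gens -(vaE k) -(vcE k); apply: (ideal_gen_foldr idP) => /=.
do !split; try exact: Pc.
apply: (K_sub_P Pf); apply: mem_ideal_gen; rewrite K2d_gens_cat /K0_gens /=.
exact: mem_head.
Qed.

Hypothesis f2 : phi2 f = 0.

(** Every [cc i * f] lies in [Kx], so [f] is congruent to its value at [cc i = 0]; for [f] in Q2
    that value is a multiple of the first generator of K. *)
Lemma Kx_f : Kx f.
Proof.
have idT : is_ideal Kx := ideal_gen_ideal _.
have hT : Kx (f - zs (iota 1 4) f).
  by apply: Kx_zs => i; rewrite mem_iota => hi //; apply: K_Kx; apply/Pf/Pc.
apply/(ideal_congr idT hT).
have [t1 [t2 [t3 [t4 [t0 ->]]]]] := Q2_split f2.
rewrite /zs; hom; rewrite !mul0r !add0r mulrC; case: idT => _ _; apply.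
by apply: mem_ideal_gen; rewrite inE /K0_gens /= mem_head orbT.
Qed.

(** Modulo K, [f] is [x * t]. As [cc 3] is outside Q3 and [cc 2] outside Q5, [f] lies in both
    primary ideals; as [x] avoids Q2, Q3 and Q5, the conditions pass to [t]. *)
Lemma f_multiple : exists g, K (f - e * g).
Proof.
have [K0 KD KM] := ideal_gen_ideal (@K2d_gens k d).
have [t K0t] := ideal_gen_cons Kx_f.
have Kt : K (f - x * t).
  apply: ideal_gen_min K0t; first exact: ideal_gen_ideal.
  by move=> y hy; apply: mem_ideal_gen; rewrite K2d_gens_cat mem_cat hy.
have id3 : is_ideal (J3 N) := pideal_ideal (phi3) (bb 3) N.
have id5 : is_ideal (J5 N) := pideal_ideal (phi5) (bb 2) N.
have J3f : J3 N f.
  have /Pf /K_J3 := @Pc 3 isT; apply: (pideal_cancel (zb3P)).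
  by rewrite /phi3 /zb3; hom; hom; rewrite cc_neq0.
have J5f : J5 N f.
  have /Pf /K_J5 := @Pc 2 isT; apply: (pideal_cancel (zb2P)).
  by rewrite /phi5 /zb2; hom; hom; rewrite cc_neq0.
have J3t : J3 N t.
  have [h _] := ideal_congr id3 (K_J3 Kt); apply: (pideal_cancel (zb3P)) (h J3f).
  by rewrite /phi3 /zb3; hom; hom; rewrite expf_neq0 ?aa_neq0.
have J5t : J5 N t.
  have [h _] := ideal_congr id5 (K_J5 Kt); apply: (pideal_cancel (zb2P)) (h J5f).
  by rewrite /phi5 /zb2; hom; hom; rewrite expf_neq0 ?aa_neq0.
have t2 : phi2 t = 0.
  have := K_phi2 Kt; rewrite rmorphB f2 sub0r rmorphM => /eqP.
  rewrite oppr_eq0 mulf_eq0 rmorphXn expf_eq0 => /orP[/andP[_]|/eqP //].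
  by rewrite /phi2; hom; rewrite mulf_eq0 expf_eq0 !(negbTE (aa_neq0 k _)) andbF.
have [g Kg] := Ke_of_primary t2 J3t J5t.
by exists g; rewrite -(subrKA (x * t)); apply: KD.
Qed.

Lemma case_rest :
  same_ideal P (@Q20 k) \/ (exists alpha : k, alpha ^+ d = 1 /\ same_ideal P (@Q19_2_1 k d alpha)).
Proof.
have idK : is_ideal K := ideal_gen_ideal _.
have [K0 KD KM] := idK.
have [g Kg] := f_multiple.
have notKg : ~ K (g * e).
  by move=> h; apply: (not_colon primeP Pf); apply/(ideal_congr idK Kg); rewrite mulrC.
have Pg r : P r -> K (r * g * e).
  move=> /Pf; have h : K (r * f - r * g * e).
    by rewrite -mulrA -mulrBr [g * e]mulrC; apply: KM.
  by have [h1 _] := ideal_congr idK h.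
have DP r : K (r * e) -> P r.
  move=> h; apply/Pf.
  have h' : K (r * f - r * (e * g)) by rewrite -mulrBr; apply: KM.
  by apply/(ideal_congr idK h'); rewrite mulrA mulrC; apply: KM.
have K1 : ~ K 1 by move=> /(K_sub_P Pf); case: primeP.
have [A [pi [hpi _]]] := quotient_exists idK K1.
have hK : Krel d (pi \o aa) (pi \o bb) (pi \o cc) by apply: K_krel => r /hpi.
(* The annihilator [D] of [e] modulo K is contained in [P], while [r * g] is in [D] for every [r] in
   [P]. *)
pose D r := pi e * pi r = 0.
have DK r : D r <-> K (r * e) by rewrite /D -rmorphM mulrC; split=> /hpi.
have idD : is_ideal D.
  split=> [|r s hr hs|r s hs]; rewrite /D; first by rewrite rmorph0 mulr0.
    by rewrite rmorphD mulrDr hr hs addr0.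
  by rewrite rmorphM mulrCA hs mulr0.
have eE : pi e = pi (aa 4) ^+ d * pi (cc 1) by rewrite rmorphM rmorphXn.
have Deq r s : pi e * pi r = pi e * pi s -> D (r - s).
  by move=> h; rewrite /D rmorphB mulrBr h subrr.
have D00 r : D (r - r) by apply: Deq.
have Da1 i : (0 < i <= 4)%N -> D (aa 1 - bb i ^+ d * aa 4).
  by move=> hi; apply: Deq; hom; apply: (krel_e_a1 hK hi).
have Da2 i : (0 < i <= 4)%N -> D (aa 2 - bb i * aa 3).
  by move=> hi; apply: Deq; hom; apply: (krel_e_a2 hK hi).
have Db32 : D (bb 3 - bb 2) by apply: Deq; hom; apply: (krel_e_b23 hK).
have Db41 : D (bb 4 - bb 1) by apply: Deq; hom; apply: (krel_e_b14 hK).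
have [/= ec1 ec3 ec4] := krel_e_c hK.
have Dc1 : D (cc 1 - bb 2 ^+ N * cc 2) by apply: Deq; hom.
have Dc3 : D (cc 3 - cc 2) by apply: Deq; hom.
have Dc4 : D (cc 4 - bb 2 ^+ N * cc 2) by apply: Deq; hom; rewrite ec4.
have [/= eb3 eb4] := krel_e_b12 hK.
have Db12a3 : D ((bb 1 - bb 2) * aa 3) by rewrite /D; hom.
have Db12a4 : D ((bb 1 ^+ d - bb 2 ^+ d) * aa 4) by rewrite /D; hom.
have Dc2 : D ((bb 1 - bb 2) * cc 2).
  have := @krel_e_bb _ _ _ _ _ hK 2 1 isT isT => /= h; rewrite /D; hom.
  by rewrite -[RHS]oppr0 -h; ring.
have Pb41 : P (bb 4 - bb 1) by apply/DP/DK.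
have Pb32 : P (bb 3 - bb 2) by apply/DP/DK.
have Pswap r s : P (r - s) -> P (s - r).
  by move=> h; rewrite -opprB -mulN1r; apply: (primeMl primeP).
have Pa1 : P (aa 1 - bb 2 ^+ d * aa 4) by apply/DP/DK/Da1.
have Pa2 : P (aa 2 - bb 2 * aa 3) by apply/DP/DK/Da2.
have Pa2' : P (aa 3) -> P (aa 2).
  by move=> h; apply/(ideal_congr idP Pa2); apply: (primeMl primeP).
have Pb12 : P ((bb 1 - bb 2) * aa 3) by apply/DP/DK.
have Pbd : P ((bb 1 ^+ d - bb 2 ^+ d) * aa 4) by apply/DP/DK.
have [s [us hs [sz es]]] := unity_roots.
have ep := prod_homogeneous es sz.
have [g20|g20] := eqVneq (phi20 g) 0; last first.
  left; have P20 r : P r -> phi20 r = 0.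
    move=> /Pg /(colon_Q20); rewrite rmorphM => /eqP.
    by rewrite mulf_eq0 (negbTE g20) orbF => /eqP.
  have Pa3 : P (aa 3).
    case/PM: Pb12 => // /P20; rewrite /phi20; hom => h.
    by have := bb12_neq0; rewrite h eqxx.
  have Pa4 : P (aa 4).
    case/PM: Pbd => // /P20; rewrite /phi20; hom => /(congr1 (zb2)); rewrite /zb2; hom.
    rewrite (exprd0) subr0 => /eqP.
    by rewrite expf_eq0 (negbTE (bb_neq0 k 1)) andbF.
  move=> r; split=> [/P20 h|]; first exact/Q20P.
  rewrite /Q20 /C1_gens -(vaE k) -(vbE k) -(vcE k); apply: (ideal_gen_foldr idP) => /=.
  do !split; [exact: Pc | exact: Pc | exact: Pc | exact: Pc | exact: Pswap | exact: Pswap | |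
    exact: Pa2' | exact: Pa3 | exact: Pa4].
  by apply/(ideal_congr idP Pa1); apply: (primeMl primeP).
have [/allP hall|/allPn [alpha]] := boolP (all (fun z => phi19 z g == 0) (rem 1 s)); last first.
  rewrite mem_rem_uniq // inE hs => /andP[a1 /eqP ad] ga; right; exists alpha; split=> //.
  have P19 r : P r -> phi19 alpha r = 0.
    move=> /Pg /(colon_Q19 ad); rewrite rmorphM => /eqP.
    by rewrite mulf_eq0 (negbTE ga) orbF => /eqP.
  have Pa3 : P (aa 3).
    case/PM: Pb12 => // /P19; rewrite /phi19; hom => h.
    have := sub_root_neq0 (_ : 1 != alpha); rewrite eq_sym a1 scale1r h => /(_ isT).
    by rewrite eqxx.
  have Pb : P (bb 2 - alpha *: bb 1).
    have : P (bb 2 ^+ d - bb 1 ^+ d).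
      case/PM: Pbd => [/Pswap //|/P19]; rewrite /phi19; hom => h.
      by have := aa_neq0 k 4; rewrite h eqxx.
    rewrite ep => h.
    have [beta] : exists beta, P (bb 2 - beta *: bb 1).
      elim: (s) h => [|z s' IH]; first by rewrite big_nil; case: primeP.
      by rewrite big_cons => /PM [|/IH //]; exists z.
    move=> Pbeta; have [->//|ab] := eqVneq alpha beta.
    have := P19 _ Pbeta; rewrite -mul_mpolyC /phi19; hom; rewrite substC mul_mpolyC => h0.
    by have := sub_root_neq0 ab; rewrite h0 eqxx.
  move=> r; split=> [/P19 h|]; first exact/Q19P.
  rewrite /Q19_2_1 /C1_gens -(vaE k) -(vbE k) -(vcE k); apply: (ideal_gen_foldr idP) => /=.
  by do !split; [exact: Pc | exact: Pc | exact: Pc | exact: Pc | exact: Pswap | exact: Pswap |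
    exact: Pa2' | exact: Pa3 | exact: Pa1 | exact: Pb].
(* Now [g] lies in Q20 and in every Q19 with [alpha] other than 1. Together with Q17 this yields a
   multiple of [(bb 1 ^+ d - bb 2 ^+ d) * aa 4], which [e] kills: Q17 supplies the factor of the
   root 1, Q20 supplies [aa 4], and the other roots supply the rest. *)
exfalso; apply: notKg; apply/DK.
have g17 : phi17 g = 0.
  have nz r : phi17 r != 0 -> forall r', phi17 (r * r') = 0 -> phi17 r' = 0.
    move=> hr r'; rewrite rmorphM => /eqP; rewrite mulf_eq0 (negbTE hr).
    by move=> /eqP.
  have f17 : phi17 f = 0.
    apply: (nz (cc 2)); first by rewrite /phi17; hom; rewrite cc_neq0.
    by apply: K_phi17; apply/Pf/Pc.
  apply: (nz e).
    rewrite /phi17; hom; rewrite !mulf_neq0 ?expf_neq0 ?aa_neq0 ?bb_neq0 ?cc_neq0 //.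
  by have := K_phi17 Kg; rewrite rmorphB f17 sub0r => /eqP; rewrite oppr_eq0 => /eqP.
pose rho : {rmorphism R -> R} := sub (four (bb 2 ^+ d * aa 4) (bb 2 * aa 3) (aa 3) (aa 4))
  (four (bb 1) (bb 2) (bb 2) (bb 1)) (four (bb 2 ^+ N * cc 2) (cc 2) (cc 2) (bb 2 ^+ N * cc 2)).
pose nu : {rmorphism R -> R} := sub (four (bb 2 ^+ d * aa 4) 0 0 (aa 4))
  (four (bb 1) (bb 2) (bb 2) (bb 1)) (fun=> 0).
have Drho : D (g - rho g).
  rewrite /rho /=; apply: (sub_congr idD); four_cases; split=> /=;
  by first [exact: D00 | exact: Da1 | exact: Da2 | exact: Db32 | exact: Db41
           | exact: Dc1 | exact: Dc3 | exact: Dc4].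
apply/(ideal_congr idD Drho).
have [u eu] : divides (bb 1 - bb 2) (rho g).
  apply: (divisor_ker (zb12P)); rewrite -g17 /zb12 /rho /phi17 /=.
  by apply: sub_sub; four_cases; hom.
rewrite eu.
have idY : is_ideal (fun r => D ((bb 1 - bb 2) * r)).
  have [D0 DD DM] := idD.
  split=> [|r t hr ht|r t ht]; first by rewrite mulr0.
    by rewrite mulrDr; apply: DD.
  by rewrite mulrCA; apply: DM.
have [D0 DD DM] := idD.
have tY r t : D (r - t) -> D ((bb 1 - bb 2) * t) -> D ((bb 1 - bb 2) * r).
  by move=> h ht; rewrite -(subrK t r) mulrDr; apply: DD => //; apply: DM.
(* Next to [bb 1 - bb 2], the variables [aa 2], [aa 3] and all the [cc i] vanish modulo [D]; this is
   what [nu] adds to [rho]. *)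
have Dnu r : D ((bb 1 - bb 2) * (r - nu r)).
  rewrite /nu /=; apply: (sub_congr idY).
  have Y00 t : D ((bb 1 - bb 2) * (t - t)) by rewrite subrr mulr0.
  four_cases; split; rewrite /= ?subr0; try exact: Y00.
  - exact/DM/Da1.
  - by apply: tY Dc1 _; rewrite mulrCA; apply: DM.
  - by apply: (tY _ _ (@Da2 2%N isT)); rewrite mulrCA; apply: DM.
  - exact: Dc2.
  - exact: Db12a3.
  - exact: DM.
  - exact: (tY _ _ Dc3).
  - exact: DM.
  - by apply: tY Dc4 _; rewrite mulrCA; apply: DM.
apply/(ideal_congr idY (Dnu u)).
have [w ew] : divides (aa 4) (nu u).
  apply: (divisor_ker (za4P)).
  have -> : za4 (nu u) = phi20 u.
    by rewrite /za4 /nu /phi20 /=; apply: sub_sub; four_cases; hom; rewrite ?mulr0.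
  have : phi20 (rho g) = 0.
    by rewrite -g20 /phi20 /rho /=; apply: sub_sub; four_cases; hom; rewrite ?mulr0.
  rewrite eu rmorphM => /eqP; rewrite mulf_eq0 => /orP[|/eqP //].
  by rewrite /phi20; hom; rewrite (negbTE (bb12_neq0)).
(* Since [nu] is idempotent, the cofactor of [aa 4] can be taken in its image, where setting [bb 2]
   to [z *: bb 1] amounts to [phi19 z]. *)
have nunu : nu u = aa 4 * nu w.
  have <- : nu (nu u) = nu u.
    by rewrite /nu /=; apply: sub_sub; four_cases; hom.
  by rewrite ew rmorphM /nu; hom.
have hw z : z \in rem 1 s -> zr z (nu w) = 0.
  move=> zs; have := zs; rewrite mem_rem_uniq // inE hs => /andP[z1 /eqP zd].
  have zP : (z%:MP_[14]) ^+ d = 1 :> R by rewrite -rmorphXn zd rmorph1.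
  have scale_d : (z *: bb 1) ^+ d = bb 1 ^+ d.
    by rewrite -mul_mpolyC exprMn zP mul1r.
  have zr_nu r : zr z (nu r) = phi19 z r.
    by rewrite /zr /nu /phi19 /=; apply: sub_sub; four_cases; hom; rewrite ?scale_d.
  have h1 : phi19 z (rho g) = 0.
    rewrite -(eqP (hall z zs)) /phi19 /rho /=; apply: sub_sub.
    by four_cases; hom; rewrite ?scale_d ?mulr0.
  have : zr z (nu u) = 0.
    rewrite zr_nu; move: h1; rewrite eu rmorphM => /eqP; rewrite mulf_eq0 => /orP[|/eqP //].
    rewrite /phi19; hom; rewrite -{1}[bb 1]scale1r => /eqP h0.
    by have := sub_root_neq0 (_ : 1 != z); rewrite eq_sym z1 h0 => /(_ isT); rewrite eqxx.
  rewrite nunu rmorphM => /eqP; rewrite mulf_eq0 => /orP[|/eqP //].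
  by rewrite /zr; hom; rewrite (negbTE (aa_neq0 k 4)).
have [v ev] := divides_roots (rem_uniq 1 us) hw.
rewrite nunu ev; move: ep; rewrite (big_rem 1) /=; last by rewrite hs expr1n.
rewrite scale1r => ep.
have -> : (bb 1 - bb 2) * (aa 4 * (\prod_(z <- rem 1 s) (bb 2 - z *: bb 1) * v)) =
    v * ((bb 1 ^+ d - bb 2 ^+ d) * aa 4).
  by rewrite -[bb 1 ^+ d - _]opprB ep; ring.
exact: DM.
Qed.
End CaseC.

End MayrMeyer.

(** * Case analysis on the variables outside P *)

Theorem theorem2p7 (k : closedFieldType) (d : nat)
  (hd : (2 <= d)%N) (hchar : (d%:R : k) != 0)
  (P : {mpoly k[14]} -> Prop) :
  Ass (@K2d k d) P ->
  (exists L : {set 'I_4}, L != set0 /\ same_ideal P (@Q1 k L))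
  \/ same_ideal P (@Q2 k d) \/ same_ideal P (@Q3 k) \/ same_ideal P (@Q5 k)
  \/ same_ideal P (@Q17_2 k d) \/ same_ideal P (@Q18_2 k d) \/ same_ideal P (@Q20 k)
  \/ (exists alpha : k, alpha ^+ d = 1 /\ same_ideal P (@Q19_2_1 k d alpha)).
Proof.
case=> primeP [f Pf]; have d0 : (0 < d)%N by apply: ltnW.
have pdec Q := excluded_middle_informative Q.
case: (pdec (exists2 i, (0 < i <= 4)%N & ~ P (vc k i))) => [[i hi Pci]|hc]; last first.
  have Pc i : (0 < i <= 4)%N -> P (vc k i).
    by move=> hi; case: (pdec (P (vc k i))) => // h; case: hc; exists i.
  have [f2|f2] := eqVneq (phi2 k d f) 0; last first.
    by right; left; apply: (case_Q2 d0 primeP Pf Pc f2).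
  by do 6!right; apply: (case_rest d0 hchar primeP Pf Pc f2).
case: (pdec (P (va k 4))) => Pa4.
  by left; apply: (case_Q1 primeP Pf hi Pa4 Pci).
case: (pdec (P (vc k 2))) => Pc2; last first.
  case: (pdec (P (vb k 2))) => Pb2.
    by do 3!right; left; apply: (case_Q5 d0 primeP Pf Pa4 Pc2 Pb2).
  by do 4!right; left; apply: (case_Q17 primeP Pf Pa4 Pc2 Pb2).
case: (pdec (P (vc k 3))) => Pc3; last first.
  by do 2!right; left; apply: (case_Q3 d0 primeP Pf Pa4 Pc2 Pc3).
(* With b04 outside [P] and c12, c13 inside, the first two of the last five generators force c11 and
   c14 into [P], against the choice of [i]. *)
exfalso; have idP := prime_ideal primeP.
have cancel r s : P (va k 4 ^+ d * r - s) -> P s -> P r.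
  move=> h Ps; have [_ /(_ Ps)] := ideal_congr idP h.
  by case/(primeM primeP) => // /(primeX primeP).
have Kn n : (n < 5)%N -> P (K_gens k d)`_n.
  move=> hn; apply: (K_sub_P Pf); apply: mem_ideal_gen.
  by rewrite K2d_gens_cat mem_cat mem_nth ?orbT.
have Pc1 : P (vc k 1) by apply: cancel (Kn 0 isT) _; apply: (primeMl primeP).
have Pc4 : P (vc k 4) by apply: cancel (Kn 1 isT) _; apply: (primeMl primeP).
by case: i hi Pci => [|[|[|[|[|i]]]]].
Qed.
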